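(* Let $(M,g,Z,\mu)$ be a Ricci soliton with potential vector field $Z\in\Gamma((\mathrm{Ker}F_\ast)^\perp)$, where $F:(M^m,g)\to(N^n,h)$ is a horizontally homothetic conformal submersion from the Riemannian manifold $M$ to an Einstein manifold $N$ such that the fibers of $F$ are totally geodesic and $(\mathrm{Ker}F_\ast)^\perp$ is integrable. Then $Z$ is a conformal vector field on $(\mathrm{Ker}F_\ast)^\perp$.
   Context: A Ricci soliton $(M,g,\xi,\mu)$ is a Riemannian manifold $(M,g)$ with a smooth vector field $\xi$ (the potential vector field) and a constant $\mu\in\mathbb{R}$ such that $\frac12L_\xi g+\mathrm{Ric}+\mu g=0$, where $L_\xi g$ is the Lie derivative of $g$ and $\mathrm{Ric}$ the Ricci tensor. A horizontally conformal submersion with dilation $\lambda$ is a surjective smooth submersion $F:(M,g)\to(N,h)$ between Riemannian manifolds together with a smooth function $\lambda:M\to\mathbb{R}^+$ such that $h(F_\ast X,F_\ast Y)=\lambda^2(p)\,g(X,Y)$ for all $p\in M$ and all $X,Y\in(\mathrm{Ker}F_{\ast p})^\perp$. It is horizontally homothetic if the horizontal part of $\mathrm{grad}\,\lambda$ vanishes, where the horizontal distribution is $(\mathrm{Ker}F_\ast)^\perp$ and the vertical distribution is $\mathrm{Ker}F_\ast$. The fibers are totally geodesic if $\nabla_UV$ is vertical for all vertical vector fields $U,V$, $\nabla$ being the Levi-Civita connection of $g$. A vector field $\xi$ is conformal if $L_\xi g=2fg$ for a smooth function $f$ (its potential function); ''$Z$ is a conformal vector field on $(\mathrm{Ker}F_\ast)^\perp$''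 means there is a smooth function $f$ on $M$ with $(L_Zg)(X,Y)=2f\,g(X,Y)$ for all $X,Y\in\Gamma((\mathrm{Ker}F_\ast)^\perp)$. *)

(* Defs.v *)
From HB Require Import structures.
From mathcomp Require Import all_boot all_order all_algebra.
From mathcomp Require Import all_classical all_reals all_analysis.

Set Implicit Arguments.
Unset Strict Implicit.
Unset Printing Implicit Defensive.

Import Order.TTheory GRing.Theory Num.Theory.
Import numFieldNormedType.Exports.

Local Open Scope classical_set_scope.
Local Open Scope ring_scope.

(* Points and vectors of R^m are row vectors, so that a Jacobian acts on the
   right: 'd f x v = v *m 'J f x.  Geometric objects on a manifold are given by
   their components in every chart of an atlas; the value of such a component
   at a point outside the domain of the chart is irrelevant. *)

Section Smooth.
Variables (R : realType) (m : nat).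

Definition partial (i : 'I_m) (f : 'rV[R]_m -> R) : 'rV[R]_m -> R :=
  fun x => 'D_(delta_mx 0 i) f x.

Fixpoint C_on (k : nat) (U : set 'rV[R]_m) (f : 'rV[R]_m -> R) : Prop :=
  {in U, continuous f} /\
  if k is k'.+1 then
    forall i : 'I_m,
      (forall x, U x -> derivable f x (delta_mx 0 i)) /\
      C_on k' U (partial i f)
  else True.

(* Meant for open U. *)
Definition smooth_on (U : set 'rV[R]_m) (f : 'rV[R]_m -> R) : Prop :=
  forall k, C_on k U f.

End Smooth.

Record chart (R : realType) (m : nat) (T : topologicalType) := Chart {
  cdom : set T;
  cmap : T -> 'rV[R]_m;
  cinv : 'rV[R]_m -> T;
  cdom_open : open cdom;
  cimg_open : open (cmap @` cdom);
  cmapK : {in cdom, cancel cmap cinv};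
  cmap_continuous : {in cdom, continuous cmap};
  cinv_continuous : {in cmap @` cdom, continuous cinv}
}.

(* The atlas is not required to be maximal: objects given in the charts of an
   atlas extend uniquely to all compatible charts. *)
Record manifold (R : realType) (m : nat) := Manifold {
  carrier :> topologicalType;
  index : Type;
  atlas : index -> chart R m carrier;
  carrier_hausdorff : hausdorff_space carrier;
  carrier_second_countable : @second_countable carrier;
  atlas_cover : forall p : carrier, exists c, cdom (atlas c) p;
  atlas_compatible : forall (c c' : index) (j : 'I_m),
    smooth_on (cmap (atlas c) @` (cdom (atlas c) `&` cdom (atlas c')))
              (fun x => cmap (atlas c') (cinv (atlas c) x) 0 j)
}.

Arguments index {R m} M : rename.
Arguments atlas {R m} M c : rename.

Section Manifold.
Variables (R : realType) (m : nat) (M : manifold R m).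
Implicit Types (c : index M) (p : M) (i j k l r : 'I_m).

Definition dom c : set M := cdom (atlas M c).
Definition coord c : M -> 'rV[R]_m := cmap (atlas M c).
Definition param c : 'rV[R]_m -> M := cinv (atlas M c).

Definition transition c c' p : 'M[R]_m := 'J (coord c' \o param c) (coord c p).

Definition smooth_in_chart c (s : M -> R) : Prop :=
  smooth_on (coord c @` dom c) (s \o param c).

Definition smooth_fun (s : M -> R) : Prop := forall c, smooth_in_chart c s.

Definition pd c i (s : M -> R) p : R := partial i (s \o param c) (coord c p).

Record vector_field := VectorField {
  vcomp :> index M -> M -> 'rV[R]_m;
  vcomp_smooth : forall c i, smooth_in_chart c (fun p => vcomp c p 0 i);
  vcomp_change : forall c c' p, dom c p -> dom c' p ->
    vcomp c' p = vcomp c p *m transition c c' p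
}.

Definition inner (G : 'M[R]_m) (u v : 'rV[R]_m) : R := (u *m G *m v^T) 0 0.

Record metric := Metric {
  gcomp :> index M -> M -> 'M[R]_m;
  gcomp_smooth : forall c i j, smooth_in_chart c (fun p => gcomp c p i j);
  gcomp_sym : forall c p, dom c p -> (gcomp c p)^T = gcomp c p;
  gcomp_pos : forall c p, dom c p ->
    forall v : 'rV[R]_m, v != 0 -> 0 < inner (gcomp c p) v v;
  gcomp_change : forall c c' p, dom c p -> dom c' p ->
    gcomp c p = transition c c' p *m gcomp c' p *m (transition c c' p)^T
}.

Implicit Types (g : metric) (X Y xi : vector_field).

(* Gamma^k_ij *)
Definition christoffel g c k i j : M -> R := fun p =>
  2^-1 * \sum_l invmx (g c p) k l *
    (pd c i (fun q => g c q j l) p + pd c j (fun q => g c q i l) p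
     - pd c l (fun q => g c q i j) p).

(* The components of nabla_X Y, nabla the Levi-Civita connection. *)
Definition nabla g X Y c p : 'rV[R]_m := \row_k
  (\sum_i X c p 0 i * pd c i (fun q => Y c q 0 k) p
   + \sum_i \sum_j christoffel g c k i j p * X c p 0 i * Y c p 0 j).

(* R(d_i, d_j) d_k = \sum_l (riemann l k i j) d_l, where
   R(X, Y) = [nabla_X, nabla_Y] - nabla_[X, Y]. *)
Definition riemann g c l k i j p : R :=
  pd c i (christoffel g c l j k) p - pd c j (christoffel g c l i k) p
  + \sum_r (christoffel g c l i r p * christoffel g c r j k p
            - christoffel g c l j r p * christoffel g c r i k p).

(* Ric(Y, Z) is the trace of X |-> R(X, Y) Z; it is positive on spheres. *)
Definition ricci g c p : 'M[R]_m :=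
  \matrix_(j, k) \sum_i riemann g c i k i j p.

Definition einstein g : Prop :=
  exists a : R, forall c p, dom c p -> ricci g c p = a *: g c p.

Definition lie_metric xi g c p : 'M[R]_m := \matrix_(i, j) \sum_k
  (xi c p 0 k * pd c k (fun q => g c q i j) p
   + g c p k j * pd c i (fun q => xi c q 0 k) p
   + g c p i k * pd c j (fun q => xi c q 0 k) p).

Definition ricci_soliton g xi (mu : R) : Prop := forall c p, dom c p ->
  2^-1 *: lie_metric xi g c p + ricci g c p + mu *: g c p = 0.

(* du(v) = inner g (grad u) v *)
Definition grad g (u : M -> R) c p : 'rV[R]_m :=
  (\row_i pd c i u p) *m invmx (g c p).

(* A distribution: D c p v says that the tangent vector at p with components v
   in the chart c belongs to the distribution. *)
Definition distribution := index M -> M -> 'rV[R]_m -> Prop.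

Definition section_of (D : distribution) X : Prop :=
  forall c p, dom c p -> D c p (X c p).

(* D is integrable, of rank r: through every point p passes an integral
   manifold, here given by an immersion s of an open subset W of R^r, whose
   tangent spaces are those of D. *)
Definition integrable_distribution (r : nat) (D : distribution) : Prop :=
  forall p, exists (W : set 'rV[R]_r) (s : 'rV[R]_r -> M),
    [/\ open W,
        exists2 x, W x & s x = p,
        {in W, continuous s},
        (forall c j,
           smooth_on (W `&` s @^-1` dom c) (fun x => coord c (s x) 0 j)) &
        forall c x, W x -> dom c (s x) ->
          row_free ('J (coord c \o s) x) /\
          forall v : 'rV[R]_m,
            D c (s x) v <-> exists t : 'rV[R]_r, v = t *m 'J (coord c \o s) x].

Definition conformal_on (D : distribution) g xi : Prop :=
  exists2 f : M -> R, smooth_fun f &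
    forall X Y, section_of D X -> section_of D Y ->
    forall c p, dom c p ->
      inner (lie_metric xi g c p) (X c p) (Y c p)
      = 2 * f p * inner (g c p) (X c p) (Y c p).

End Manifold.

Section Submersion.
Variables (R : realType) (m n : nat) (M : manifold R m) (N : manifold R n).
Variables (g : metric M) (h : metric N) (F : M -> N).

Definition smooth_map : Prop :=
  continuous F /\
  forall (c : index M) (d : index N) (j : 'I_n),
    smooth_on (coord c @` (dom c `&` F @^-1` dom d))
              (fun x => coord d (F (param c x)) 0 j).

(* The matrix of F_* at p in the charts c and d. *)
Definition differential (c : index M) (d : index N) (p : M) : 'M[R]_(m, n) :=
  'J (coord d \o F \o param c) (coord c p).

Definition submersion : Prop :=
  smooth_map /\
  forall c d p, dom c p -> dom d (F p) -> row_full (differential c d p).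

Definition vertical : distribution M := fun c p v =>
  forall d, dom d (F p) -> v *m differential c d p = 0.

Definition horizontal : distribution M := fun c p v =>
  forall u, vertical c p u -> inner (g c p) v u = 0.

Definition is_horizontal_part (c : index M) (p : M) (v w : 'rV[R]_m) : Prop :=
  horizontal c p w /\ vertical c p (v - w).

Definition conformal_submersion (lambda : M -> R) : Prop :=
  [/\ submersion,
      set_surj setT setT F,
      smooth_fun lambda,
      forall p, 0 < lambda p &
      forall c d p, dom c p -> dom d (F p) ->
      forall v w, horizontal c p v -> horizontal c p w ->
        inner (h d (F p)) (v *m differential c d p) (w *m differential c d p)
        = lambda p ^+ 2 * inner (g c p) v w].

Definition horizontally_homothetic (lambda : M -> R) : Prop :=
  forall c p, dom c p -> is_horizontal_part c p (grad g lambda c p) 0.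

Definition totally_geodesic_fibers : Prop :=
  forall U V : vector_field M,
    section_of vertical U -> section_of vertical V ->
    forall c p, dom c p -> vertical c p (nabla g U V c p).

End Submersion.

(* Main.v *)
From HB Require Import structures.
From mathcomp Require Import all_boot all_order all_algebra.
From mathcomp Require Import all_classical all_reals all_analysis.
From mathcomp Require Import ring lra.
Require Import Defs.

Set Implicit Arguments.
Unset Strict Implicit.
Unset Printing Implicit Defensive.

Import Order.TTheory GRing.Theory Num.Theory.
Import numFieldNormedType.Exports.

Local Open Scope classical_set_scope.
Local Open Scope ring_scope.

(** On horizontal vectors the soliton equation reads
    [L_Z g = - 2 (Ric + mu g)]. It is therefore enough that, on horizontal
    vectors, the Ricci tensor of [g] be a smooth multiple of [g]. Geometrically
    this is because [M] is locally a warped product of the base, with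
    metric [lambda^-2 h], and a fiber: integrability and totally geodesic
    fibers give the product, and the dilation is a function on the fiber. The
    proof below obtains the Ricci tensor in arbitrary charts of [M] and [N],
    without constructing product coordinates.

    Let [theta = d (log lambda)], which vanishes on horizontal vectors. The key
    point is that the second fundamental form of [F] is
    [nabla dF = theta * dF + dF * theta] ([second_form_alongE]). On two vertical
    vectors both sides vanish, as the fibers are totally geodesic
    ([second_form_vertical]). On a horizontal and a vertical vector, the
    derivative of the conformality relation ([second_form_conformal])
    determines the symmetric part of the left hand side, and the
    integrability of the horizontal distribution kills the skew part
    ([second_form_integrable]). On two horizontal vectors the left hand side is
    given by a trilinear form with incompatible symmetries, hence zero
    ([second_form_horizontal]).

    This formula says that [F] is affine from a connection projectively
    equivalent to the Levi-Civita connection of [g] to that of [h]. Commuting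
    its derivatives expresses [dF (R (X, Y) W)] by the curvature of the base and
    by [nabla theta] ([curvature_differential]). The curvatures of [g] and [h]
    are skew ([curvature_skew]), so that this suffices to compute the trace
    [Ric (Y, W)] for horizontal [Y] and [W]. The result is
    [Ric_h (dF Y, dF W) + (tau + |theta|^2) g (Y, W)] for a function [tau]
    ([ricci_horizontal]), and the first term is [a lambda^2 g (Y, W)] when
    [Ric_h = a h].

    The factor so obtained is smooth. It does not depend on the charts, since
    the Lie derivative of a metric is a tensor ([lie_metric_change]).

    Vectors are rows, so that the differential of [F] is the matrix [D] with
    [v |-> v *m D], and a connection is a family of matrices. The calculus this
    needs is the chain rule, Schwarz's theorem and the stability of smooth
    functions under the usual operations; bump functions turn
    vertical vectors into global vertical fields ([localized_field]). *)

(** * Mean value theorem and differentiability of C^1 functions *)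

Section MeanValue.
Variables (R : realType) (V : normedModType R).
Implicit Types (f : V -> R) (x v : V).

Lemma is_derive_line f x v (t : R) : derivable f (x + t *: v) v ->
  is_derive t 1 (fun s => f (x + s *: v)) ('D_v f (x + t *: v)).
Proof.
move=> df.
have E : (fun h => h^-1 *: (f (x + (h *: 1 + t) *: v) - f (x + t *: v)))
       = (fun h => h^-1 *: (f (h *: v + (x + t *: v)) - f (x + t *: v))).
  by apply/funext => h; rewrite [h *: 1]mulr1 scalerDl addrCA.
split; first by rewrite /derivable /= E.
by rewrite /derive /= E.
Qed.

Lemma MVT_line_pos f x v (s : R) : 0 <= s ->
  (forall t, 0 <= t <= s -> derivable f (x + t *: v) v) ->
  exists2 t, 0 <= t <= s & f (x + s *: v) - f x = s * 'D_v f (x + t *: v).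
Proof.
move=> s0 df.
have [|||t ts E] := @MVT_segment R (fun t => f (x + t *: v))
  (fun t => 'D_v f (x + t *: v)) 0 s.
- exact: s0.
- move=> t /[!in_itv]/= /andP[t0 ts]; apply: is_derive_line; apply: df.
  by rewrite !ltW.
- apply: derivable_within_continuous => t /[!in_itv]/= ts.
  by have [] := is_derive_line (df t ts).
- exists t; first by move: ts; rewrite in_itv.
  by move: E; rewrite scale0r addr0 subr0 mulrC.
Qed.

Lemma MVT_line f x v (s : R) :
  (forall t, `|t| <= `|s| -> derivable f (x + t *: v) v) ->
  exists2 t, `|t| <= `|s| & f (x + s *: v) - f x = s * 'D_v f (x + t *: v).
Proof.
move=> df; have [s0|s0] := leP 0 s.
  have [||t /andP[t0 ts] E] := @MVT_line_pos f x v s.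
  - exact: s0.
  - by move=> t /andP[t0 ts]; apply: df; rewrite !ger0_norm.
  - by exists t => //; rewrite !ger0_norm.
have Ns0 : 0 <= - s by rewrite oppr_ge0 ltW.
have [||t /andP[t0 ts]] := @MVT_line_pos f (x + s *: v) v (- s).
- exact: Ns0.
- move=> t /andP[t0 ts]; rewrite -addrA -scalerDl; apply: df.
  by rewrite !ler0_norm; lra.
rewrite -!addrA -!scalerDl subrr scale0r addr0 => E.
exists (s + t); first by rewrite !ler0_norm; lra.
by rewrite -opprB E mulNr opprK.
Qed.

End MeanValue.

Section C1.
Variables (R : realType).

Lemma differentiable_of_expansion (V W : normedModType R) (f : V -> W)
  (df : {linear V -> W}) x : continuous df ->
  f \o shift x = cst (f x) + df +o_ 0 id -> differentiable f x.
Proof.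
move=> dfc dfx; have E := diff_unique dfc dfx.
by apply/diff_locallyP; rewrite E.
Qed.

Variable m : nat.
Implicit Types (U : set 'rV[R]_m) (f : 'rV[R]_m -> R).

Local Notation e i := (delta_mx 0 i : 'rV[R]_m).

Lemma norm_delta_le (i : 'I_m) : `|e i| <= 1 :> R.
Proof.
rewrite [X in X <= _]/Num.Def.normr/= mx_normrE.
apply/bigmax_leP; split=> // -[a b] _; rewrite !mxE /=.
by case: (_ && _); rewrite ?normr1 ?normr0.
Qed.

Lemma coord_le_norm (h : 'rV[R]_m) i : `|h 0 i| <= `|h|.
Proof.
rewrite [X in _ <= X]/Num.Def.normr/= mx_normrE.
exact: (@le_bigmax _ _ _ _ _ (ord0, i)).
Qed.

Lemma norm_row_le (h k : 'rV[R]_m) :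
  (forall i, `|h 0 i| <= `|k 0 i|) -> `|h| <= `|k|.
Proof.
move=> hk; rewrite [X in X <= _]/Num.Def.normr/= mx_normrE.
apply/bigmax_leP; split=> // -[a b] _; rewrite (ord1 a) /=.
exact: le_trans (hk b) (coord_le_norm _ _).
Qed.

(** The vertices of the polygonal path from 0 to [h] parallel to the axes. *)
Definition trunc_row (h : 'rV[R]_m) (k : nat) : 'rV[R]_m :=
  \row_j (if (j < k)%N then h 0 j else 0).

Lemma trunc_rowS (h : 'rV[R]_m) (i : 'I_m) :
  trunc_row h i.+1 = trunc_row h i + h 0 i *: e i.
Proof.
apply/rowP => j; rewrite !mxE eqxx /= ltnS leq_eqVlt.
have [->|ji] := eqVneq j i; first by rewrite eqxx ltnn /= mulr1 add0r.
rewrite mulr0 addr0 [(_ == _ :> nat)](_ : _ = false) //.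
exact: negbTE.
Qed.

(** Move from [x] to [x + h] one coordinate at a time: by the mean value
    theorem each step contributes a coordinate of [h] times a partial
    derivative at a point close to [x], and the partial derivatives are
    continuous. *)
Lemma C1_differentiable U f x : open U -> U x ->
  (forall i y, U y -> derivable f y (e i)) ->
  (forall i, {for x, continuous (partial i f)}) ->
  differentiable f x.
Proof.
move=> oU Ux df cf.
pose c : 'cV[R]_m := \col_i partial i f x.
pose L (h : 'rV[R]_m) : R := \sum_i h 0 i * partial i f x.
have Llin : linear L.
  move=> a u v; rewrite /L scaler_sumr -big_split; apply: eq_bigr => i _.
  by rewrite !mxE mulrDl scalerAl.
pose LM := GRing.isLinear.Build _ _ _ _ L Llin.
pose LL : {linear 'rV[R]_m -> R} := HB.pack L LM.
have Lc : continuous (LL : 'rV[R]_m -> R).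
  move=> y; apply: differentiable_continuous.
  have -> : (LL : _ -> _) = \sum_i (fun h : 'rV[R]_m => h 0 i * partial i f x).
    by apply/funext => h; rewrite fct_sumE.
  apply: differentiable_sum => i.
  by apply: differentiableM; [exact: differentiable_coord|].
apply: (differentiable_of_expansion (df := LL)) => //.
apply/eqaddoP => eps eps0.
pose eps' := eps / m.+1%:R.
have eps'0 : 0 < eps' by rewrite divr_gt0.
have N1 : \forall y \near x, U y by exact: open_nbhs_nbhs.
have N2 : \forall y \near x, forall i, `|partial i f x - partial i f y| <= eps'.
  apply: (@filter_forall _ _
    (fun i y => `|partial i f x - partial i f y| <= eps') (nbhs x)) => i.
  by have /cvgrPdist_le/(_ eps' eps'0) := cf i.
have N3 : nbhs x (fun y => U y /\
  forall i, `|partial i f x - partial i f y| <= eps') by exact: filterI N1 N2.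
have /nbhs_ballP[del /= del0 Hdel] := N3.
near=> h.
have hdel : `|h| < del.
  by near: h; exact: (@nbhs0_lt R 'rV[R]_m).
have Hin y : `|y| <= `|h| -> ball x del (x + y).
  move=> yh; rewrite -ball_normE /= opprD addrA subrr sub0r normrN.
  exact: le_lt_trans hdel.
rewrite /= !fctE /=.
have T0 : trunc_row h 0 = 0 by apply/rowP => j; rewrite !mxE.
have Tm : trunc_row h m = h by apply/rowP => j; rewrite !mxE ltn_ord.
have Tle k : `|trunc_row h k| <= `|h|.
  by apply: norm_row_le => j; rewrite mxE; case: ifP => // _; rewrite normr0.
have tele : f (h + x) - f x
    = \sum_(i < m) (f (x + trunc_row h i.+1) - f (x + trunc_row h i)).
  rewrite -(big_mkord xpredT (fun i => f (x + trunc_row h i.+1) - f (x + trunc_row h i))).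
  by rewrite telescope_sumr // T0 Tm addr0 [h + x]addrC.
rewrite opprD addrA tele /L -sumrB.
apply: (le_trans (ler_norm_sum _ _ _)).
have step (i : 'I_m) : `|f (x + trunc_row h i.+1) - f (x + trunc_row h i)
    - h 0 i * partial i f x| <= eps' * `|h|.
  rewrite trunc_rowS addrA.
  have near_t t : `|t| <= `|h 0 i| ->
      ball x del (x + trunc_row h i + t *: e i).
    move=> th; rewrite -addrA; apply: Hin; apply: norm_row_le => j.
    rewrite !mxE eqxx /=.
    have [ji|ji] := eqVneq j i; last first.
      by rewrite mulr0 addr0; case: ifP => // _; rewrite normr0.
    by rewrite ji ltnn add0r mulr1.
  have [t th|t th ->] := @MVT_line R _ f (x + trunc_row h i) (e i) (h 0 i).
    by apply: df; case: (Hdel _ (near_t t th)).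
  rewrite -mulrBr normrM mulrC; apply: ler_pM => //; last exact: coord_le_norm.
  by rewrite distrC; case: (Hdel _ (near_t t th)) => _ /(_ i).
apply: (@le_trans _ _ (\sum_(i < m) eps' * `|h|)).
  by apply: ler_sum => i _; exact: step.
rewrite sumr_const card_ord -mulr_natr mulrAC ler_wpM2r //.
rewrite /eps' -mulrA ler_piMr //; first exact: ltW.
by rewrite mulrC ler_pdivrMr // mul1r ler_nat.
Unshelve. all: by end_near. Qed.

End C1.

(** * Rules for partial derivatives *)

Section PartialDerivatives.
Variables (R : realType) (m : nat).
Implicit Types (U V : set 'rV[R]_m) (f g : 'rV[R]_m -> R) (x : 'rV[R]_m).

Local Notation e i := (delta_mx 0 i : 'rV[R]_m).

Lemma in_continuousE U f :
  {in U, continuous f} <-> forall x, U x -> {for x, continuous f}.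
Proof. by split=> H x Ux; apply: H; rewrite ?inE // -inE. Qed.

(** Values outside [U] are arbitrary in all that follows, so that functions are
    only ever compared on an open set. *)
Lemma partial_eq U f g i x : open U -> U x -> (forall y, U y -> f y = g y) ->
  partial i f x = partial i g x.
Proof.
move=> oU Ux fg; apply: near_eq_derive.
by have : \forall y \near x, U y by [exact: open_nbhs_nbhs]; apply: filterS.
Qed.

Lemma partialD f g i x : differentiable f x -> differentiable g x ->
  partial i (fun y => f y + g y) x = partial i f x + partial i g x.
Proof. by move=> df dg; apply: deriveD; apply: diff_derivable. Qed.

Lemma partialM f g i x : differentiable f x -> differentiable g x ->
  partial i (fun y => f y * g y) x = partial i f x * g x + f x * partial i g x.
Proof.
move=> df dg; rewrite /partial.
have := @deriveM R _ f g x (e i) (diff_derivable df) (diff_derivable dg).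
move=> ->.
by rewrite addrC [_ *: _]mulrC.
Qed.

Lemma partial_cst (a : R) i x : partial i (fun _ => a) x = 0.
Proof. exact: derive_cst. Qed.

Lemma partial_coord i j x : partial i (fun y : 'rV[R]_m => y 0 j) x = (i == j)%:R.
Proof.
rewrite /partial /derive.
have E : (fun h : R => h^-1 *: ((h *: e i + x) 0 j - x 0 j)) @ 0^' --> ((i == j)%:R : R).
  apply: (@cvg_trans _ ((fun=> (i == j)%:R : R) @ 0^')); last exact: cvg_cst.
  apply: near_eq_cvg; near=> h.
  rewrite !mxE /= addrK [j == i]eq_sym -[_ *: _]/(h^-1 * _) mulrA mulVf ?mul1r //.
  by near: h; exact: nbhs_dnbhs_neq.
exact: cvg_lim E.
Unshelve. all: by end_near. Qed.

Lemma partialV f i x : differentiable f x -> f x != 0 ->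
  partial i (fun y => (f y)^-1) x = - partial i f x * (f x)^-1 * (f x)^-1.
Proof.
move=> df f0; rewrite /partial.
have := @deriveV R _ f x (e i) f0 (diff_derivable df).
move=> ->.
by rewrite -[_ *: _]/(_ * _) expr2 invfM; ring.
Qed.

Lemma differentiable_row n (phi : 'rV[R]_m -> 'rV[R]_n) x :
  (forall j, differentiable (fun y => phi y 0 j) x) -> differentiable phi x.
Proof.
move=> dphi.
have -> : phi = \sum_j (fun y => phi y 0 j *: (delta_mx 0 j : 'rV[R]_n)).
  by apply/funext => y; rewrite fct_sumE; exact: row_sum_delta.
by apply: differentiable_sum => j; exact: differentiableZl.
Qed.

Lemma jacobianE n (phi : 'rV[R]_m -> 'rV[R]_n) x i j :
  (forall j, differentiable (fun y => phi y 0 j) x) ->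
  ('J phi x) i j = partial i (fun y => phi y 0 j) x.
Proof.
move=> dphi; have dphi' := differentiable_row dphi.
rewrite mxE -deriveE // derive_mx ?mxE //.
exact: diff_derivable.
Qed.

Lemma partial_comp n (phi : 'rV[R]_m -> 'rV[R]_n) (f : 'rV[R]_n -> R) i x :
  (forall j, differentiable (fun y => phi y 0 j) x) ->
  differentiable f (phi x) ->
  partial i (f \o phi) x
  = \sum_j partial i (fun y => phi y 0 j) x * partial j f (phi x).
Proof.
move=> dphi df; have dphi' := differentiable_row dphi.
rewrite /partial deriveE; last exact: differentiable_comp.
rewrite diff_comp //=.
have -> : 'd phi x (e i) = \sum_j 'D_(e i) (fun y => phi y 0 j) x *: delta_mx 0 j.
  rewrite -deriveE // derive_mx; last exact: diff_derivable.
  by rewrite [LHS]row_sum_delta; apply: eq_bigr => j _; rewrite mxE.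
rewrite linear_sum; apply: eq_bigr => j _.
by rewrite linearZ /= -(deriveE _ df).
Qed.

Lemma partial_comp1 (f : R -> R) (df : R -> R) (s : 'rV[R]_m -> R) i x :
  is_derive (s x) 1 f (df (s x)) -> differentiable s x ->
  partial i (f \o s) x = df (s x) * partial i s x.
Proof.
move=> [fd fE] ds.
have fd' : differentiable f (s x) by exact/derivable1_diffP.
rewrite /partial deriveE; last exact: differentiable_comp.
rewrite diff_comp //= deriv1E // derive1E fE -deriveE //.
by rewrite -[_ *: _]/(_ * _) mulrC.
Qed.

Lemma continuous_row (T : topologicalType) n (phi : T -> 'rV[R]_n) (x : T) :
  (forall j, {for x, continuous (fun y => phi y 0 j)}) ->
  {for x, continuous phi}.
Proof.
move=> cphi; apply/cvgrPdist_le => eps eps0.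
have N : \forall y \near x, forall j, `|phi x 0 j - phi y 0 j| <= eps.
  apply: (@filter_forall _ _
    (fun j y => `|phi x 0 j - phi y 0 j| <= eps) (nbhs x)) => j.
  by have /cvgrPdist_le/(_ eps eps0) := cphi j.
near=> y.
rewrite [X in X <= _]/Num.Def.normr/= mx_normrE.
apply: bigmax_le; first exact: ltW.
move=> [a b] _; rewrite (ord1 a) !mxE /=.
by move: b; near: y.
Unshelve. all: by end_near. Qed.

End PartialDerivatives.

(** * Functions of class C^k *)

Section ContinuousDifferentiability.
Variables (R : realType) (m : nat).
Implicit Types (U V : set 'rV[R]_m) (f g : 'rV[R]_m -> R) (x : 'rV[R]_m).

Local Notation e i := (delta_mx 0 i : 'rV[R]_m).

Lemma C_on_continuous k U f x : C_on k U f -> U x -> {for x, continuous f}.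
Proof. by case: k => [|k] [/in_continuousE cf _]; exact: cf. Qed.

Lemma C_on_partial k U f i : C_on k.+1 U f -> C_on k U (partial i f).
Proof. by move=> [_ /(_ i)[]]. Qed.

Lemma C_on_differentiable k U f x : open U -> C_on k.+1 U f -> U x ->
  differentiable f x.
Proof.
move=> oU Cf Ux; apply: (C1_differentiable oU Ux).
  by move=> i y Uy; case: Cf => _ /(_ i)[+ _]; apply.
by move=> i; exact: C_on_continuous (C_on_partial i Cf) Ux.
Qed.

(** Continuity of [f] comes from its differentiability: inductions on [k] only
    have to deal with the partial derivatives. *)
Lemma C_onS k U f : open U ->
  (forall x, U x -> differentiable f x) ->
  (forall i, C_on k U (partial i f)) -> C_on k.+1 U f.
Proof.
move=> oU df Cf; split.
  apply/in_continuousE => x Ux.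
  exact: differentiable_continuous (df x Ux).
by move=> i; split=> // x Ux; apply: diff_derivable; exact: df.
Qed.

Lemma continuous_near_eq U f g x : open U -> U x ->
  (forall y, U y -> f y = g y) ->
  {for x, continuous f} -> {for x, continuous g}.
Proof.
move=> oU Ux fg cf; rewrite /prop_for /continuous_at -(fg x Ux).
apply: (@cvg_trans _ (f @ x)); last exact: cf.
have N : {near nbhs x, f =1 g}.
  by near=> y; apply: fg; near: y; exact: open_nbhs_nbhs.
exact: (@near_eq_cvg _ _ (nbhs x) _ f g N).
Unshelve. all: by end_near. Qed.

Lemma C_on_eq k U f g : open U -> (forall x, U x -> f x = g x) ->
  C_on k U f -> C_on k U g.
Proof.
move=> oU; elim: k f g => [|k IH] f g fg Cf.
  split=> //; apply/in_continuousE => x Ux.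
  exact: continuous_near_eq oU Ux fg (C_on_continuous Cf Ux).
split.
  apply/in_continuousE => x Ux.
  exact: continuous_near_eq oU Ux fg (C_on_continuous Cf Ux).
move=> i; split.
  move=> x Ux; have N : {near x, f =1 g}.
    by near=> y; apply: fg; near: y; exact: open_nbhs_nbhs.
  apply: (near_eq_derivable N).
  by case: Cf => _ /(_ i)[+ _]; apply.
apply: (IH (partial i f)); last exact: C_on_partial.
by move=> x Ux; exact: (partial_eq i oU Ux fg).
Unshelve. all: by end_near. Qed.

Lemma C_on_le k U f : C_on k.+1 U f -> C_on k U f.
Proof.
elim: k f => [|k IH] f [cf df]; first by split.
split=> // i; have [di Ci] := df i.
by split=> //; exact: IH.
Qed.

Lemma C_on_sub k U V f : V `<=` U -> C_on k U f -> C_on k V f.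
Proof.
move=> VU; elim: k f => [|k IH] f [/in_continuousE cf df].
  by split=> //; apply/in_continuousE => x /VU; exact: cf.
split; first by apply/in_continuousE => x /VU; exact: cf.
move=> i; have [di Ci] := df i; split; last exact: IH.
by move=> x /VU; exact: di.
Qed.

(** Smoothness being local, a function given by different formulas on the pieces
    of an open cover can be treated piece by piece. *)
Lemma C_on_local k U f :
  (forall x, U x -> exists V, V x /\ C_on k V f) -> C_on k U f.
Proof.
elim: k f => [|k IH] f loc.
  split=> //; apply/in_continuousE => x /loc [V [Vx Cf]].
  exact: C_on_continuous Cf Vx.
split.
  apply/in_continuousE => x /loc [V [Vx Cf]].
  exact: C_on_continuous Cf Vx.
move=> i; split.
  by move=> x /loc [V [Vx [_ /(_ i)[+ _]]]]; apply.
by apply: IH => x /loc [V [Vx Cf]]; exists V; split=> //; exact: C_on_partial.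
Qed.

Lemma C_on_cst k U (a : R) : C_on k U (fun _ => a).
Proof.
elim: k a => [|k IH] a; split=> //.
- by apply/in_continuousE => x _; exact: cst_continuous.
- by apply/in_continuousE => x _; exact: cst_continuous.
move=> i; split; first by move=> x _; exact: derivable_cst.
rewrite (_ : partial i _ = fun _ => 0); first exact: IH.
by apply/funext => x; rewrite partial_cst.
Qed.

Lemma C_on_coord k U j : C_on k U (fun x => x 0 j).
Proof.
case: k => [|k]; split=> //.
- by apply/in_continuousE => x _; exact: coord_continuous.
- by apply/in_continuousE => x _; exact: coord_continuous.
move=> i; split.
  by move=> x _; apply: diff_derivable; exact: differentiable_coord.
rewrite (_ : partial i _ = fun _ => (i == j)%:R); first exact: C_on_cst.
by apply/funext => x; rewrite partial_coord.
Qed.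

Lemma C_onD k U f g : open U -> C_on k U f -> C_on k U g ->
  C_on k U (fun x => f x + g x).
Proof.
move=> oU; elim: k f g => [|k IH] f g Cf Cg.
  split=> //; apply/in_continuousE => x Ux.
  exact: continuousD (C_on_continuous Cf Ux) (C_on_continuous Cg Ux).
apply: C_onS => // [x Ux|i].
  by apply: differentiableD; apply: (C_on_differentiable oU _ Ux); eassumption.
apply: (C_on_eq oU (f := fun x => partial i f x + partial i g x)).
  by move=> x Ux; rewrite partialD //; apply: (C_on_differentiable oU _ Ux); eassumption.
by apply: IH; exact: C_on_partial.
Qed.

Lemma C_onM k U f g : open U -> C_on k U f -> C_on k U g ->
  C_on k U (fun x => f x * g x).
Proof.
move=> oU; elim: k f g => [|k IH] f g Cf Cg.
  split=> //; apply/in_continuousE => x Ux.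
  exact: continuousM (C_on_continuous Cf Ux) (C_on_continuous Cg Ux).
apply: C_onS => // [x Ux|i].
  by apply: differentiableM; apply: (C_on_differentiable oU _ Ux); eassumption.
apply: (C_on_eq oU (f := fun x => partial i f x * g x + f x * partial i g x)).
  by move=> x Ux; rewrite partialM //; apply: (C_on_differentiable oU _ Ux); eassumption.
by apply: C_onD => //; apply: IH; do ?[exact: C_on_partial|exact: C_on_le].
Qed.

Lemma C_on_sum k U (I : Type) (r : seq I) (P : pred I) (F : I -> 'rV[R]_m -> R) :
  open U -> (forall i, C_on k U (F i)) ->
  C_on k U (fun x => \sum_(i <- r | P i) F i x).
Proof.
move=> oU CF; elim: r => [|a r IH].
  by under [X in C_on k U X]funext do rewrite big_nil; exact: C_on_cst.
under [X in C_on k U X]funext do rewrite big_cons.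
by case: (P a) => //; exact: C_onD.
Qed.

Lemma C_on_prod k U (I : Type) (r : seq I) (P : pred I) (F : I -> 'rV[R]_m -> R) :
  open U -> (forall i, C_on k U (F i)) ->
  C_on k U (fun x => \prod_(i <- r | P i) F i x).
Proof.
move=> oU CF; elim: r => [|a r IH].
  by under [X in C_on k U X]funext do rewrite big_nil; exact: C_on_cst.
under [X in C_on k U X]funext do rewrite big_cons.
by case: (P a) => //; exact: C_onM.
Qed.

Lemma C_onV k U f : open U -> (forall x, U x -> f x != 0) -> C_on k U f ->
  C_on k U (fun x => (f x)^-1).
Proof.
move=> oU f0; elim: k => [|k IH] Cf.
  split=> //; apply/in_continuousE => x Ux.
  have fx := f0 x Ux.
  exact: (@cvgV R _ (nbhs x) _ f (f x) fx (C_on_continuous Cf Ux)).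
apply: C_onS => // [x Ux|i].
  apply: differentiableV; last exact: f0.
  exact: C_on_differentiable oU Cf Ux.
apply: (C_on_eq oU (f := fun x => -1 * partial i f x * (f x)^-1 * (f x)^-1)).
  move=> x Ux; rewrite mulN1r.
  by rewrite (partialV _ (C_on_differentiable oU Cf Ux) (f0 x Ux)).
have := IH (C_on_le Cf) => Vf.
do 2![apply: C_onM => //]; apply: C_onM => //; first exact: C_on_cst.
exact: C_on_partial.
Qed.

Lemma is_derive_translate f x v c (d : R) :
  is_derive (x + c) v f d -> is_derive x v (fun y => f (y + c)) d.
Proof.
move=> [fd fE].
have E : (fun h : R => h^-1 *: (f (h *: v + x + c) - f (x + c)))
       = (fun h : R => h^-1 *: (f (h *: v + (x + c)) - f (x + c))).
  by apply/funext => h; rewrite addrA.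
by split; [rewrite /derivable /= E | rewrite /derive /= E].
Qed.

(** Two applications of the mean value theorem evaluate the second difference
    of [f] on a small square as a mixed derivative at some point of it. *)
Lemma second_difference U f (a b : 'I_m) x (s : R) :
  (forall t u, `|t| <= `|s| -> `|u| <= `|s| -> U (x + t *: e a + u *: e b)) ->
  open U -> C_on 2 U f ->
  exists t u, [/\ `|t| <= `|s|, `|u| <= `|s| &
   f (x + s *: e a + s *: e b) - f (x + s *: e b) - (f (x + s *: e a) - f x)
   = s * s * partial a (partial b f) (x + t *: e a + u *: e b)].
Proof.
move=> Uin oU Cf.
have df y : U y -> differentiable f y by exact: C_on_differentiable oU Cf.
have dfb y : U y -> differentiable (partial b f) y.
  exact: C_on_differentiable oU (C_on_partial b Cf).
have s0 : `|0 : R| <= `|s| by rewrite normr0.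
pose F y := f (y + s *: e a) - f y.
have dF u : `|u| <= `|s| -> is_derive (x + u *: e b) (e b) F
     (partial b f (x + s *: e a + u *: e b) - partial b f (x + u *: e b)).
  move=> us.
  have U1 : U (x + s *: e a + u *: e b) by exact: Uin.
  have U2 : U (x + u *: e b) by have := Uin 0 u s0 us; rewrite scale0r addr0.
  have D1 : is_derive (x + u *: e b) (e b) (fun y => f (y + s *: e a))
      (partial b f (x + s *: e a + u *: e b)).
    apply: is_derive_translate; rewrite addrAC.
    exact/derivableP/diff_derivable/df.
  have D2 : is_derive (x + u *: e b) (e b) f (partial b f (x + u *: e b)).
    exact/derivableP/diff_derivable/df.
  exact: is_deriveB.
have [|u us Eu] := @MVT_line R _ F x (e b) s.
  by move=> u us; have [] := dF u us.
have [_ dFu] := dF u us.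
have [|t ts Et] := @MVT_line R _ (partial b f) (x + u *: e b) (e a) s.
  by move=> t ts; rewrite addrAC; apply/diff_derivable/dfb/Uin.
exists t, u; split; [exact: ts|exact: us|].
move: Eu; rewrite dFu [x + s *: e a + _]addrAC Et [x + u *: e b + _]addrAC.
by rewrite /F [x + s *: e b + _]addrAC mulrA => <-.
Qed.

(** Schwarz's theorem. The second difference is symmetric in the two directions,
    so both mixed derivatives take a common value at two points close to [x]. *)
Lemma partial_comm U f i j x : open U -> C_on 2 U f -> U x ->
  partial i (partial j f) x = partial j (partial i f) x.
Proof.
move=> oU Cf Ux.
apply/eqP; rewrite -subr_eq0 -normr_le0; apply/ler_addgt0Pl => eps eps0.
rewrite addr0.
have eps2 : 0 < eps / 2 by rewrite divr_gt0.
have near_mixed a b : nbhs x (fun y => U y /\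
    `|partial a (partial b f) x - partial a (partial b f) y| <= eps / 2).
  have N1 : \forall y \near x, U y by exact: open_nbhs_nbhs.
  have N2 : \forall y \near x,
      `|partial a (partial b f) x - partial a (partial b f) y| <= eps / 2.
    have Cab := C_on_partial a (C_on_partial b Cf).
    by have /cvgrPdist_le/(_ _ eps2) := C_on_continuous Cab Ux.
  exact: filterI N1 N2.
have N3 : nbhs x (fun y => (U y /\
    `|partial i (partial j f) x - partial i (partial j f) y| <= eps / 2) /\
    (U y /\ `|partial j (partial i f) x - partial j (partial i f) y| <= eps / 2)).
  exact: filterI (near_mixed i j) (near_mixed j i).
have /nbhs_ballP[del /= del0 Hdel] := N3.
pose s : R := del / 3.
have s0 : 0 < s by rewrite divr_gt0.
have ns : `|s| = s by rewrite gtr0_norm.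
have inb (a b : 'I_m) t u : `|t| <= `|s| -> `|u| <= `|s| ->
    ball x del (x + t *: e a + u *: e b).
  rewrite ns => ts us.
  rewrite -ball_normE /= -addrA opprD addrA subrr sub0r normrN.
  apply: (le_lt_trans (ler_normD _ _)); rewrite !normrZ.
  have ha := norm_delta_le R a; have hb := norm_delta_le R b.
  have := ler_pM (normr_ge0 t) (normr_ge0 _) ts ha.
  have := ler_pM (normr_ge0 u) (normr_ge0 _) us hb.
  rewrite !mulr1 => h1 h2; apply: (le_lt_trans (lerD h2 h1)).
  by rewrite /s; lra.
have Uin a b t u ts us := proj1 (proj1 (Hdel _ (inb a b t u ts us))).
have [t [u [ts us E1]]] := second_difference (Uin i j) oU Cf.
have [t' [u' [ts' us' E2]]] := second_difference (Uin j i) oU Cf.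
have E : partial i (partial j f) (x + t *: e i + u *: e j)
       = partial j (partial i f) (x + t' *: e j + u' *: e i).
  apply: (mulfI (x := s * s)); first by rewrite mulf_neq0 // gt_eqF.
  apply: (etrans (esym E1)); apply: etrans E2.
  have aux (A B C D : R) : A - B - (C - D) = A - C - (B - D) by ring.
  by rewrite [x + s *: e j + _]addrAC; exact: aux.
have [[_ B1] _] := Hdel _ (inb i j t u ts us).
have [_ [_ B2]] := Hdel _ (inb j i t' u' ts' us').
rewrite E in B1; rewrite distrC in B2.
have half (A B C : R) : `|A - B| <= eps / 2 -> `|B - C| <= eps / 2 ->
    `|A - C| <= eps.
  move=> h1 h2; rewrite (splitr eps) -(subrKA B).
  exact: le_trans (ler_normD _ _) (lerD h1 h2).
exact: half B1 B2.
Qed.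

End ContinuousDifferentiability.

(** By induction on [k]: the chain rule expresses a partial derivative of
    [h \o phi] by functions [partial j h \o phi] of one order less. *)
Lemma C_on_comp (R : realType) (m n k : nat) (U : set 'rV[R]_m)
  (W : set 'rV[R]_n) (phi : 'rV[R]_m -> 'rV[R]_n) :
  open U -> open W -> (forall x, U x -> W (phi x)) ->
  (forall j, C_on k U (fun x => phi x 0 j)) ->
  forall h : 'rV[R]_n -> R, C_on k W h -> C_on k U (h \o phi).
Proof.
move=> oU oW UW; elim: k => [|k IH] Cphi h Ch.
  split=> //; apply/in_continuousE => x Ux.
  have ch : {for phi x, continuous h} := C_on_continuous Ch (UW x Ux).
  apply: (@continuous_comp _ _ _ phi h x _ ch).
  by apply: continuous_row => j; exact: C_on_continuous (Cphi j) Ux.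
have dphi x j : U x -> differentiable (fun y => phi y 0 j) x.
  by move=> Ux; exact: (C_on_differentiable oU (Cphi j) Ux).
have dh y : W y -> differentiable h y by exact: (C_on_differentiable oW Ch).
apply: C_onS => // [x Ux|i].
  apply: differentiable_comp; last exact: dh (UW x Ux).
  by apply: differentiable_row => j; exact: dphi.
apply: (C_on_eq oU (f := fun x =>
    \sum_j partial i (fun y => phi y 0 j) x * (partial j h \o phi) x)).
  move=> x Ux; rewrite partial_comp //; last exact: dh (UW x Ux).
  by move=> j; exact: dphi.
apply: C_on_sum => // j; apply: C_onM => //; first exact: C_on_partial.
apply: IH; last exact: C_on_partial.
by move=> l; exact: C_on_le.
Qed.

(** * Bump functions *)

Section FlatFunction.
Variable R : realType.

(** The case [k = 0] is the classical smooth function which is flat at 0. The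
    family in [k] is closed under differentiation, up to linear combinations,
    and this is what makes smoothness an induction. *)
Definition flat (k : nat) (x : R) : R :=
  if 0 < x then x^-1 ^+ k * expR (- x^-1) else 0.

Lemma flat_ge0 k x : 0 <= flat k x.
Proof.
rewrite /flat; case: ifP => // x0.
by rewrite mulr_ge0 ?expR_ge0 // exprn_ge0 // invr_ge0 ltW.
Qed.

(** With [y = 1 / x] and [n = k + 1] the bound says [y ^ n <= n ^ n exp y], which
    follows from [exp y = exp (y / n) ^ n >= (y / n) ^ n]. *)
Lemma flat_le k x : 0 < x -> flat k x <= k.+1%:R ^+ k.+1 * x.
Proof.
move=> x0; rewrite /flat x0 expRN; set y := x^-1.
have y0 : 0 < y by rewrite invr_gt0.
rewrite ler_pdivrMr ?expR_gt0 //.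
have E : y ^+ k = k.+1%:R ^+ k.+1 * x * (y / k.+1%:R) ^+ k.+1.
  have N0 : k.+1%:R ^+ k.+1 != 0 :> R by rewrite expf_neq0 ?pnatr_eq0.
  have xy : x * y = 1 by rewrite divff // gt_eqF.
  rewrite expr_div_n; move: N0; set N := k.+1%:R ^+ k.+1 => N0.
  transitivity ((x * y) * y ^+ k * (N / N)).
    by rewrite xy divff // mulr1 mul1r.
  rewrite exprS; ring.
rewrite [leLHS]E ler_wpM2l ?mulr_ge0 ?exprn_ge0 ?(ltW x0) //.
have -> : y = k.+1%:R * (y / k.+1%:R) by rewrite mulrC divfK.
rewrite [k.+1%:R * (_ / _) / _]mulrAC divff // mul1r.
rewrite expRM_natl lerXn2r ?nnegrE ?expR_ge0 // ?divr_ge0 ?(ltW y0) //.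
by apply: le_trans (expR_ge1Dx _); rewrite lerDr.
Qed.

(** At 0 the difference quotient of [flat k] is [flat k.+1], which tends to 0
    there. *)
Lemma is_derive_flat k (x : R) :
  is_derive x 1 (flat k) (flat k.+2 x - k%:R * flat k.+1 x).
Proof.
have [x0|x0|<-] := ltgtP 0 x.
- have xn0 : x != 0 by rewrite gt_eqF.
  have E : {near x, (fun y => y^-1 ^+ k * expR (- y^-1)) =1 flat k}.
    by near=> y; rewrite /flat ifT //; near: y; exact: lt_nbhsr.
  apply: (near_eq_is_derive E).
  have D1 : is_derive x 1 (fun y : R => y^-1) (- x ^- 2).
    have := @is_deriveV R id x 1 1 xn0 (is_derive_id _ _).
    by rewrite -[_ *: 1]/(_ * 1) mulr1.
  have D2 : is_derive x 1 (fun y : R => expR (- y^-1)) (expR (- x^-1) * x ^- 2).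
    have D3 : is_derive x 1 (fun y : R => - y^-1) (x ^- 2).
      by have := is_deriveN D1; rewrite opprK.
    exact: (@is_derive1_comp R expR (fun y : R => - y^-1) x _ _ (is_derive_expR _) D3).
  have D3 := is_deriveX k D1; rewrite exprfctE in D3.
  have {}D3 := is_deriveM D3 D2.
  apply: (is_derive_eq D3); rewrite /flat x0 -![_ *: _]/(_ * _) -exprVn.
  by case: k {E D3} => [|k]; rewrite ?exprS /=; ring.
- have E : {near x, (fun _ => 0) =1 flat k}.
    near=> y; rewrite /flat ifF //; apply/negbTE; rewrite -leNgt ltW //.
    by near: y; exact: lt_nbhsl.
  rewrite /flat !ltNge (ltW x0) /= mulr0 subr0.
  by apply: (near_eq_is_derive E); exact: is_derive_cst.
- have -> : flat k.+2 0 - k%:R * flat k.+1 0 = 0 by rewrite /flat ltxx mulr0 subr0.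
  have lim0 : (fun h : R => h^-1 *: (flat k (h *: 1 + 0) - flat k 0)) @ 0^' --> (0 : R).
    apply/cvgrPdist_le => eps eps0.
    pose C : R := k.+2%:R ^+ k.+2.
    have C0 : 0 < C by rewrite exprn_gt0 // ltr0n.
    near=> h.
    have hn0 : h != 0 by near: h; exact: nbhs_dnbhs_neq.
    have hs : `|h| < eps / C.
      by near: h; apply: (@dnbhs0_lt R R); rewrite divr_gt0.
    have -> : h^-1 *: (flat k (h *: 1 + 0) - flat k 0) = flat k.+1 h.
      rewrite -![_ *: _]/(_ * _) mulr1 addr0 /flat ltxx subr0.
      by case: ifP => _; rewrite ?mulr0 // exprS mulrA.
    rewrite sub0r normrN ger0_norm ?flat_ge0 //.
    have [h0|h0] := ltP 0 h; last by rewrite /flat ltNge h0 /= ltW.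
    apply: (le_trans (flat_le _ h0)); rewrite -/C mulrC -ler_pdivlMr //.
    by rewrite -(gtr0_norm h0) ltW.
  split; first by apply/cvg_ex; exists 0.
  exact: cvg_lim lim0.
Unshelve. all: by end_near. Qed.

End FlatFunction.

Section Bump.
Variables (R : realType) (m : nat).
Implicit Types (U : set 'rV[R]_m) (x : 'rV[R]_m).

Lemma C_on_flat k j U (s : 'rV[R]_m -> R) : open U -> C_on k U s ->
  C_on k U (flat j \o s).
Proof.
move=> oU; elim: k j => [|k IH] j Cs.
  split=> //; apply/in_continuousE => x Ux.
  apply: (@continuous_comp _ _ _ s (flat j) x (C_on_continuous Cs Ux)).
  apply: differentiable_continuous; apply/derivable1_diffP.
  by have [] := is_derive_flat j (s x).
have ds x : U x -> differentiable s x by exact: (C_on_differentiable oU Cs).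
apply: C_onS => // [x Ux|i].
  apply: differentiable_comp; first exact: ds.
  by apply/derivable1_diffP; have [] := is_derive_flat j (s x).
apply: (C_on_eq oU (f := fun x =>
   ((flat j.+2 \o s) x + - j%:R * (flat j.+1 \o s) x) * partial i s x)).
  move=> x Ux.
  have := partial_comp1 (df := fun y => flat j.+2 y - j%:R * flat j.+1 y) i
    (is_derive_flat j (s x)) (ds x Ux).
  by move=> ->; rewrite mulNr.
have Cs' := C_on_le Cs.
apply: C_onM => //; last exact: C_on_partial.
apply: C_onD => //; first exact: IH.
by apply: C_onM => //; [exact: C_on_cst|exact: IH].
Qed.

(** A product over the coordinates, so that the support is a ball for the sup
    norm, which is the norm of row vectors. *)
Definition bump (x0 : 'rV[R]_m) (r : R) (x : 'rV[R]_m) : R :=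
  \prod_i flat 0 (r * r + (-1) * ((x 0 i + - x0 0 i) * (x 0 i + - x0 0 i))).

Lemma smooth_bump x0 r U : open U -> smooth_on U (bump x0 r).
Proof.
move=> oU k; apply: C_on_prod => // i.
have Cc a : C_on k U (fun _ => a) by exact: C_on_cst.
have Ci : C_on k U (fun x => x 0 i + - x0 0 i).
  by apply: C_onD => //; exact: C_on_coord.
apply: C_on_flat => //; apply: C_onD => //.
by apply: C_onM => //; apply: C_onM.
Qed.

Lemma bump_center x0 r : 0 < r -> bump x0 r x0 != 0.
Proof.
move=> r0; apply/prodf_neq0 => i _.
rewrite subrr mulr0 mulr0 addr0 /flat mulr_gt0 // expr0 mul1r gt_eqF //.
exact: expR_gt0.
Qed.

Lemma bump_support x0 r x : 0 < r -> ~ ball x0 r x -> bump x0 r x = 0.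
Proof.
move=> r0 nb; have [i ri] : exists i, r <= `|x 0 i - x0 0 i|.
  apply: contrapT => H; apply: nb.
  rewrite -ball_normE /= [X in X < _]/Num.Def.normr/= mx_normrE.
  apply: bigmax_lt => // -[a b] _; rewrite (ord1 a) !mxE /= distrC ltNge.
  by apply/negP => h; apply: H; exists b.
rewrite /bump (bigD1 i) //= /flat ifF ?mul0r //.
apply/negbTE; rewrite -leNgt mulN1r subr_le0 -!expr2 -[leRHS]real_normK //.
  by rewrite lerXn2r ?nnegrE ?(ltW r0).
exact: num_real.
Qed.

End Bump.

(** * Smooth functions in a chart *)

Section ChartCalculus.
Variables (R : realType) (m : nat) (M : manifold R m).
Implicit Types (c : index M) (O : set M) (s t : M -> R) (p q : M).

Lemma coordK c p : dom c p -> param c (coord c p) = p.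
Proof. by move=> cp; apply: (cmapK (c := atlas M c)); rewrite inE. Qed.

Lemma open_coord_image c O : open O -> O `<=` dom c -> open (coord c @` O).
Proof.
move=> oO Oc; rewrite openE => _ [p Op <-].
have pc := Oc p Op.
have img : (cmap (atlas M c) @` cdom (atlas M c)) (coord c p) by exists p.
have cont : {for coord c p, continuous (param c)}.
  by apply: (cinv_continuous (c := atlas M c)); rewrite inE.
have N1 : nbhs (coord c p) (param c @^-1` O).
  by apply: cont; rewrite coordK //; exact: open_nbhs_nbhs.
have N2 : nbhs (coord c p) (cmap (atlas M c) @` cdom (atlas M c)).
  by apply: open_nbhs_nbhs; split=> //; exact: cimg_open.
have sub : (param c @^-1` O) `&` (cmap (atlas M c) @` cdom (atlas M c))
    `<=` coord c @` O.
  move=> x [Ox [q qc qx]]; exists q => //.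
  by move: Ox; rewrite /= -qx (_ : cmap (atlas M c) q = coord c q) // coordK.
exact: filterS sub (filterI N1 N2).
Qed.

(** Open parts [O] of a chart are needed because maps and changes of charts are
    only given by smooth formulas where the two charts involved overlap. The
    prefixes [sm] and, for matrices, [smx] mark closure properties of this
    notion. *)
Definition smooth_within c O s : Prop :=
  smooth_on (coord c @` O) (s \o param c).

Section Region.
Variables (c : index M) (O : set M).
Hypotheses (oO : open O) (Oc : O `<=` dom c).

Local Notation sm := (smooth_within c O).
Let oI := open_coord_image oO Oc.

Lemma coord_param_eq s t : (forall q, O q -> s q = t q) ->
  forall x, (coord c @` O) x -> (s \o param c) x = (t \o param c) x.
Proof. by move=> st _ [q Oq <-] /=; rewrite coordK; [exact: st|exact: Oc]. Qed.

Lemma sm_eq s t : (forall q, O q -> s q = t q) -> sm s -> sm t.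
Proof. by move=> st Cs k; apply: C_on_eq (coord_param_eq st) (Cs k). Qed.

Lemma pd_eq i s t p : O p -> (forall q, O q -> s q = t q) ->
  pd c i s p = pd c i t p.
Proof.
move=> Op st; apply: (partial_eq _ oI _ (coord_param_eq st)).
by exists p.
Qed.

Lemma sm_differentiable s p : sm s -> O p ->
  differentiable (s \o param c) (coord c p).
Proof. by move=> Cs Op; apply: (C_on_differentiable oI (Cs 1%N)); exists p. Qed.

Lemma sm_cst (a : R) : sm (fun=> a).
Proof. by move=> k; exact: C_on_cst. Qed.

Lemma smD s t : sm s -> sm t -> sm (fun q => s q + t q).
Proof. by move=> Cs Ct k; exact: (C_onD oI (Cs k) (Ct k)). Qed.

Lemma smM s t : sm s -> sm t -> sm (fun q => s q * t q).
Proof. by move=> Cs Ct k; exact: (C_onM oI (Cs k) (Ct k)). Qed.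

Lemma smN s : sm s -> sm (fun q => - s q).
Proof.
move=> Cs; apply: (sm_eq (s := fun q => -1 * s q)).
  by move=> q _; rewrite mulN1r.
by apply: smM => //; exact: sm_cst.
Qed.

Lemma sm_sum (I : Type) (r : seq I) (P : pred I) (f : I -> M -> R) :
  (forall i, sm (f i)) -> sm (fun q => \sum_(i <- r | P i) f i q).
Proof.
move=> Cf k.
exact: (C_on_sum r P (F := fun i => f i \o param c) oI (fun i => Cf i k)).
Qed.

Lemma sm_prod (I : Type) (r : seq I) (P : pred I) (f : I -> M -> R) :
  (forall i, sm (f i)) -> sm (fun q => \prod_(i <- r | P i) f i q).
Proof.
move=> Cf k.
exact: (C_on_prod r P (F := fun i => f i \o param c) oI (fun i => Cf i k)).
Qed.

Lemma smV s : sm s -> (forall q, O q -> s q != 0) -> sm (fun q => (s q)^-1).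
Proof.
move=> Cs s0 k; apply: (C_onV oI _ (Cs k)) => _ [q Oq <-] /=.
by rewrite coordK; [exact: s0|exact: Oc].
Qed.

Lemma sm_pd i s : sm s -> sm (pd c i s).
Proof.
move=> Cs k.
apply: (C_on_eq oI (f := partial i (s \o param c))); last first.
  exact: C_on_partial (Cs k.+1).
by move=> _ [q Oq <-]; rewrite /= /pd coordK //; exact: Oc.
Qed.

Lemma sm_sub O' s : O' `<=` O -> sm s -> smooth_within c O' s.
Proof. by move=> O'O Cs k; apply: C_on_sub (Cs k); exact: image_subset. Qed.

Lemma pd_cst i (a : R) p : pd c i (fun=> a) p = 0.
Proof. exact: partial_cst. Qed.

Lemma pdD i s t p : O p -> sm s -> sm t ->
  pd c i (fun q => s q + t q) p = pd c i s p + pd c i t p.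
Proof.
move=> Op Cs Ct.
exact: (partialD i (sm_differentiable Cs Op) (sm_differentiable Ct Op)).
Qed.

Lemma pdM i s t p : O p -> sm s -> sm t ->
  pd c i (fun q => s q * t q) p = pd c i s p * t p + s p * pd c i t p.
Proof.
move=> Op Cs Ct.
have := partialM i (sm_differentiable Cs Op) (sm_differentiable Ct Op).
by rewrite /= coordK //; exact: Oc.
Qed.

Lemma pdV i s p : O p -> sm s -> s p != 0 ->
  pd c i (fun q => (s q)^-1) p = - pd c i s p * (s p)^-1 * (s p)^-1.
Proof.
move=> Op Cs s0.
have := partialV i (sm_differentiable Cs Op).
by rewrite /= coordK; [apply|exact: Oc].
Qed.

Lemma pdN i s p : O p -> sm s -> pd c i (fun q => - s q) p = - pd c i s p.
Proof.
move=> Op Cs; rewrite (pd_eq i (t := fun q => -1 * s q) Op).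
  by rewrite pdM // ?pd_cst ?mul0r ?add0r ?mulN1r //; exact: sm_cst.
by move=> q _; rewrite mulN1r.
Qed.

Lemma pd_sum i (I : Type) (r : seq I) (P : pred I) (f : I -> M -> R) p :
  O p -> (forall j, sm (f j)) ->
  pd c i (fun q => \sum_(j <- r | P j) f j q) p
  = \sum_(j <- r | P j) pd c i (f j) p.
Proof.
move=> Op Cf; elim: r => [|j r IH].
  by under [X in pd c i X]funext do rewrite big_nil; rewrite big_nil pd_cst.
under [X in pd c i X]funext do rewrite big_cons.
rewrite big_cons; case: (P j) => //.
by rewrite pdD // ?IH //; exact: sm_sum.
Qed.

Lemma pd_comm i j s p : O p -> sm s ->
  pd c i (pd c j s) p = pd c j (pd c i s) p.
Proof.
move=> Op Cs.
have E k l : pd c k (pd c l s) p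
    = partial k (partial l (s \o param c)) (coord c p).
  apply: (partial_eq _ oI); first by exists p.
  by move=> _ [q Oq <-]; rewrite /= /pd coordK //; exact: Oc.
rewrite !E; apply: (partial_comm _ _ oI (Cs 2%N)).
by exists p.
Qed.

End Region.

Lemma sm_local c s : (forall p, dom c p ->
    exists O, [/\ open O, O p, O `<=` dom c & smooth_within c O s]) ->
  smooth_in_chart c s.
Proof.
move=> loc k; apply: C_on_local => _ [p cp <-].
have [U [oU Up Uc Cs]] := loc p cp.
by exists (coord c @` U); split; [exists p|exact: Cs].
Qed.

End ChartCalculus.

Section Maps.
Variables (R : realType) (m n : nat) (M : manifold R m) (N : manifold R n).
Variables (F : M -> N) (c : index M) (d : index N) (O : set M) (V : set N).
Hypotheses (oO : open O) (Oc : O `<=` dom c).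
Hypotheses (oV : open V) (Vd : V `<=` dom d) (FOV : forall q, O q -> V (F q)).
Hypothesis smF : forall a, smooth_within c O (fun q => coord d (F q) 0 a).

Let oI := open_coord_image oO Oc.
Let phi : 'rV[R]_m -> 'rV[R]_n := coord d \o F \o param c.

Lemma sm_comp s : smooth_within d V s -> smooth_within c O (s \o F).
Proof.
move=> Cs k.
have imV x : (coord c @` O) x -> (coord d @` V) (phi x).
  move=> [q Oq <-]; rewrite /phi /= coordK; last exact: Oc.
  by exists (F q) => //; exact: FOV.
apply: (C_on_eq oI (f := (s \o param d) \o phi)).
  move=> _ [q Oq <-]; rewrite /phi /= [param c _]coordK; last exact: Oc.
  by rewrite coordK //; exact/Vd/FOV.
apply: (C_on_comp oI (open_coord_image oV Vd) imV _ (Cs k)) => a.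
exact: smF.
Qed.

Lemma differentialE p i a : O p ->
  differential F c d p i a = pd c i (fun q => coord d (F q) 0 a) p.
Proof.
move=> Op; apply: jacobianE => b.
exact: (sm_differentiable oO Oc (smF b) Op).
Qed.

Lemma pd_comp i s p : O p -> smooth_within d V s ->
  pd c i (s \o F) p = \sum_a differential F c d p i a * pd d a s (F p).
Proof.
move=> Op Cs.
have -> : pd c i (s \o F) p = partial i ((s \o param d) \o phi) (coord c p).
  apply: (partial_eq _ oI); first by exists p.
  move=> _ [q Oq <-]; rewrite /phi /= [param c _]coordK; last exact: Oc.
  by rewrite coordK //; exact/Vd/FOV.
have phip : phi (coord c p) = coord d (F p).
  by rewrite /phi /= coordK //; exact: Oc.
rewrite partial_comp.
- apply: eq_bigr => a _; rewrite differentialE // phip.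
  by [].
- by move=> a; exact: (sm_differentiable oO Oc (smF a) Op).
by rewrite phip; apply: (sm_differentiable oV Vd Cs); exact: FOV.
Qed.

End Maps.

(** * Matrix-valued functions *)

Section MatrixFields.
Variables (R : realType) (m : nat) (M : manifold R m).

Definition dm c (i : 'I_m) (k l : nat) (X : M -> 'M[R]_(k, l)) (p : M) :
  'M[R]_(k, l) := \matrix_(a, b) pd c i (fun q => X q a b) p.

Definition smx c (O : set M) (k l : nat) (X : M -> 'M[R]_(k, l)) : Prop :=
  forall a b, smooth_within c O (fun q => X q a b).

Lemma dmE c i k l (X : M -> 'M[R]_(k, l)) p a b :
  dm c i X p a b = pd c i (fun q => X q a b) p.
Proof. by rewrite mxE. Qed.

Variables (c : Defs.index M) (O : set M).
Hypotheses (oO : open O) (Oc : O `<=` dom c).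

Local Notation sm := (smooth_within c O).

Lemma smx_eq k l (X Y : M -> 'M[R]_(k, l)) :
  (forall q, O q -> X q = Y q) -> smx c O X -> smx c O Y.
Proof.
move=> XY CX a b; apply: (sm_eq oO Oc (s := fun q => X q a b)) => // q Oq.
by rewrite XY.
Qed.

Lemma smx_cst k l (A : 'M[R]_(k, l)) : smx c O (fun=> A).
Proof. by move=> a b; exact: sm_cst. Qed.

Lemma smxD k l (X Y : M -> 'M[R]_(k, l)) :
  smx c O X -> smx c O Y -> smx c O (fun q => X q + Y q).
Proof.
move=> CX CY a b; apply: (sm_eq oO Oc (s := fun q => X q a b + Y q a b)).
  by move=> q _; rewrite mxE.
exact: smD.
Qed.

Lemma smxN k l (X : M -> 'M[R]_(k, l)) : smx c O X -> smx c O (fun q => - X q).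
Proof.
move=> CX a b; apply: (sm_eq oO Oc (s := fun q => - X q a b)).
  by move=> q _; rewrite mxE.
exact: smN.
Qed.

Lemma smxB k l (X Y : M -> 'M[R]_(k, l)) :
  smx c O X -> smx c O Y -> smx c O (fun q => X q - Y q).
Proof. by move=> CX CY; apply: smxD => //; exact: smxN. Qed.

Lemma smxM k l r (X : M -> 'M[R]_(k, l)) (Y : M -> 'M[R]_(l, r)) :
  smx c O X -> smx c O Y -> smx c O (fun q => X q *m Y q).
Proof.
move=> CX CY a b; apply: (sm_eq oO Oc (s := fun q => \sum_j X q a j * Y q j b)).
  by move=> q _; rewrite mxE.
by apply: sm_sum => // j; exact: smM.
Qed.

Lemma smxT k l (X : M -> 'M[R]_(k, l)) : smx c O X -> smx c O (fun q => (X q)^T).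
Proof.
move=> CX a b; apply: (sm_eq oO Oc (s := fun q => X q b a)) => // q _.
by rewrite mxE.
Qed.

Lemma smxZ k l (s : M -> R) (X : M -> 'M[R]_(k, l)) :
  sm s -> smx c O X -> smx c O (fun q => s q *: X q).
Proof.
move=> Cs CX a b; apply: (sm_eq oO Oc (s := fun q => s q * X q a b)).
  by move=> q _; rewrite mxE.
exact: smM.
Qed.

Lemma smx_dm i k l (X : M -> 'M[R]_(k, l)) : smx c O X -> smx c O (dm c i X).
Proof.
move=> CX a b; apply: (sm_eq oO Oc (s := pd c i (fun q => X q a b))).
  by move=> q _; rewrite mxE.
exact: sm_pd.
Qed.

Lemma smx_sum (I : Type) (r : seq I) (P : pred I) k l
  (X : I -> M -> 'M[R]_(k, l)) : (forall i, smx c O (X i)) ->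
  smx c O (fun q => \sum_(i <- r | P i) X i q).
Proof.
move=> CX; elim: r => [|j r IH].
  by under [X in smx c O X]funext do rewrite big_nil; exact: smx_cst.
under [X in smx c O X]funext do rewrite big_cons.
by case: (P j) => //; exact: smxD.
Qed.

Lemma sm_det k (X : M -> 'M[R]_k) : smx c O X -> sm (fun q => \det (X q)).
Proof.
move=> CX; apply: (sm_sum oO Oc) => s; apply: (smM oO Oc).
  exact: sm_cst.
by apply: (sm_prod oO Oc) => i; exact: CX.
Qed.

(** Cramer's rule makes the entries of the inverse rational functions of those
    of [X]. *)
Lemma smx_inv k (X : M -> 'M[R]_k) : smx c O X ->
  (forall q, O q -> X q \in unitmx) -> smx c O (fun q => invmx (X q)).
Proof.
move=> CX uX.
apply: (smx_eq (X := fun q => (\det (X q))^-1 *: \adj (X q))).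
  by move=> q Oq; rewrite /invmx uX.
apply: smxZ.
  apply: (smV oO Oc); first exact: sm_det.
  by move=> q /uX; rewrite unitmxE unitfE.
move=> a b; apply: (sm_eq oO Oc (s := fun q => cofactor (X q) b a)).
  by move=> q _; rewrite mxE.
apply: (smM oO Oc); first exact: sm_cst.
apply: sm_det => i j.
apply: (sm_eq oO Oc (s := fun q => X q (lift b i) (lift a j))).
  by move=> q _; rewrite !mxE.
exact: CX.
Qed.

Lemma dm_eq i k l (X Y : M -> 'M[R]_(k, l)) p : O p ->
  (forall q, O q -> X q = Y q) -> dm c i X p = dm c i Y p.
Proof.
move=> Op XY; apply/matrixP => a b; rewrite !mxE.
by apply: (pd_eq oO Oc) => // q Oq; rewrite XY.
Qed.

Lemma dm_cst i k l (A : 'M[R]_(k, l)) p : dm c i (fun=> A) p = 0.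
Proof. by apply/matrixP => a b; rewrite !mxE pd_cst. Qed.

Lemma dmD i k l (X Y : M -> 'M[R]_(k, l)) p : O p ->
  smx c O X -> smx c O Y ->
  dm c i (fun q => X q + Y q) p = dm c i X p + dm c i Y p.
Proof.
move=> Op CX CY; apply/matrixP => a b; rewrite !mxE.
rewrite -(pdD oO Oc i Op (CX a b) (CY a b)).
by apply: (pd_eq oO Oc) => // q _; rewrite mxE.
Qed.

Lemma dmN i k l (X : M -> 'M[R]_(k, l)) p : O p -> smx c O X ->
  dm c i (fun q => - X q) p = - dm c i X p.
Proof.
move=> Op CX; apply/matrixP => a b; rewrite !mxE -(pdN oO Oc i Op (CX a b)).
by apply: (pd_eq oO Oc) => // q _; rewrite mxE.
Qed.

Lemma dmB i k l (X Y : M -> 'M[R]_(k, l)) p : O p ->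
  smx c O X -> smx c O Y ->
  dm c i (fun q => X q - Y q) p = dm c i X p - dm c i Y p.
Proof. by move=> Op CX CY; rewrite dmD // ?dmN //; exact: smxN. Qed.

Lemma dmM i k l r (X : M -> 'M[R]_(k, l)) (Y : M -> 'M[R]_(l, r)) p : O p ->
  smx c O X -> smx c O Y ->
  dm c i (fun q => X q *m Y q) p = dm c i X p *m Y p + X p *m dm c i Y p.
Proof.
move=> Op CX CY; apply/matrixP => a b; rewrite !mxE.
rewrite (pd_eq oO Oc i (t := fun q => \sum_j X q a j * Y q j b) Op).
  rewrite (pd_sum oO Oc) // -?big_split; last by move=> j; exact: smM.
  by apply: eq_bigr => j _; rewrite !mxE (pdM oO Oc i Op (CX _ _) (CY _ _)).
by move=> q _; rewrite mxE.
Qed.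

Lemma dmT i k l (X : M -> 'M[R]_(k, l)) p :
  dm c i (fun q => (X q)^T) p = (dm c i X p)^T.
Proof.
apply/matrixP => a b; rewrite !mxE; congr (pd c i _ p).
by apply/funext => q; rewrite mxE.
Qed.

Lemma dmZ i k l (s : M -> R) (X : M -> 'M[R]_(k, l)) p : O p ->
  sm s -> smx c O X ->
  dm c i (fun q => s q *: X q) p = pd c i s p *: X p + s p *: dm c i X p.
Proof.
move=> Op Cs CX; apply/matrixP => a b; rewrite !mxE.
rewrite -(pdM oO Oc i Op Cs (CX a b)).
by apply: (pd_eq oO Oc) => // q _; rewrite mxE.
Qed.

Lemma dm_sum i (I : Type) (r : seq I) (P : pred I) k l
  (X : I -> M -> 'M[R]_(k, l)) p : O p -> (forall j, smx c O (X j)) ->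
  dm c i (fun q => \sum_(j <- r | P j) X j q) p
  = \sum_(j <- r | P j) dm c i (X j) p.
Proof.
move=> Op CX; elim: r => [|j r IH].
  by under [X in dm c i X]funext do rewrite big_nil; rewrite big_nil dm_cst.
under [X in dm c i X]funext do rewrite big_cons.
rewrite big_cons; case: (P j) => //.
by rewrite dmD // ?IH //; exact: smx_sum.
Qed.

Lemma dm_comm i j k l (X : M -> 'M[R]_(k, l)) p : O p -> smx c O X ->
  dm c i (dm c j X) p = dm c j (dm c i X) p.
Proof.
move=> Op CX; apply/matrixP => a b; rewrite [LHS]dmE [RHS]dmE.
have E u v : pd c u (fun q => dm c v X q a b) p
    = pd c u (pd c v (fun q => X q a b)) p.
  by apply: (pd_eq oO Oc) => // q _; exact: dmE.
by rewrite !E; exact: (pd_comm oO Oc i j Op (CX a b)).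
Qed.

End MatrixFields.

Section ChartChange.
Variables (R : realType) (m : nat) (M : manifold R m).

Lemma sm_coord_change c c' (O : set M) j : O `<=` dom c -> O `<=` dom c' ->
  smooth_within c O (fun q => coord c' q 0 j).
Proof.
move=> Oc Oc' k; apply: C_on_sub (atlas_compatible c c' j k).
by apply: image_subset => q Oq; split; [exact: Oc|exact: Oc'].
Qed.

Lemma sm_change c c' (O : set M) s : open O -> O `<=` dom c -> O `<=` dom c' ->
  smooth_within c O s -> smooth_within c' O s.
Proof.
move=> oO Oc Oc' Cs.
apply: (sm_comp (F := idfun) (d := c) oO Oc' oO Oc) => //.
by move=> a; exact: sm_coord_change.
Qed.

End ChartChange.

Section Composition.
Variables (R : realType) (m n k : nat).
Variables (M : manifold R m) (N : manifold R n) (P : manifold R k).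

Lemma differential_comp (F : M -> N) (G : N -> P) c d e (O : set M) (V : set N) p :
  open O -> O `<=` dom c -> open V -> V `<=` dom d ->
  (forall q, O q -> V (F q)) ->
  (forall a, smooth_within c O (fun q => coord d (F q) 0 a)) ->
  (forall a, smooth_within d V (fun q => coord e (G q) 0 a)) -> O p ->
  differential (G \o F) c e p = differential F c d p *m differential G d e (F p).
Proof.
move=> oO Oc oV Vd FOV CF CG Op; apply/matrixP => i b; rewrite [RHS]mxE.
have CGF a : smooth_within c O (fun q => coord e ((G \o F) q) 0 a).
  exact: (sm_comp oO Oc oV Vd FOV CF (CG a)).
rewrite (differentialE oO Oc CGF) //.
rewrite (pd_comp oO Oc oV Vd FOV CF i Op (CG b)).
apply: eq_bigr => a _; congr (_ * _).
by rewrite (differentialE oV Vd CG) //; exact: FOV.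
Qed.

End Composition.

(** * The Levi-Civita connection and its curvature *)

Lemma addmxE (R : realType) k l (A B : 'M[R]_(k, l)) i j :
  (A + B) i j = A i j + B i j.
Proof. by rewrite mxE. Qed.

Lemma oppmxE (R : realType) k l (A : 'M[R]_(k, l)) i j : (- A) i j = - A i j.
Proof. by rewrite mxE. Qed.

Lemma scalemxE (R : realType) k l (a : R) (A : 'M[R]_(k, l)) i j :
  (a *: A) i j = a * A i j.
Proof. by rewrite mxE. Qed.

Lemma zeromxE (R : realType) k l i j : (0 : 'M[R]_(k, l)) i j = 0.
Proof. by rewrite mxE. Qed.

Lemma trmxD (R : realType) k l (A B : 'M[R]_(k, l)) : (A + B)^T = A^T + B^T.
Proof. exact: linearD. Qed.

Lemma trmxN (R : realType) k l (A : 'M[R]_(k, l)) : (- A)^T = - A^T.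
Proof. exact: linearN. Qed.

(* Proves identities that are linear once products of matrices are regarded as
   atoms: entrywise they are linear identities between real numbers. *)
Ltac mx_linear := apply/matrixP => ? ?;
  rewrite ?(addmxE, oppmxE, scalemxE, zeromxE); ring.

Section LeviCivita.
Variables (R : realType) (m : nat) (M : manifold R m) (g : metric M).
Variables (c : Defs.index M) (O : set M).
Hypotheses (oO : open O) (Oc : O `<=` dom c).

Local Notation sm := (smooth_within c O).
Local Notation G := (g c).

Lemma metric_unit p : dom c p -> G p \in unitmx.
Proof.
move=> cp; rewrite -row_free_unit; apply: inj_row_free => v vG.
apply/eqP; apply: contraT => v0.
by have := gcomp_pos g cp v0; rewrite /inner vG mul0mx mxE ltxx.
Qed.

Lemma metric_sym p i j : dom c p -> G p i j = G p j i.
Proof. by move=> cp; rewrite -{1}(gcomp_sym g cp) mxE. Qed.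

Lemma smx_metric : smx c O G.
Proof.
by move=> i j; apply: (sm_sub Oc); exact: gcomp_smooth.
Qed.

(** The connection in the coordinate direction [i] as a matrix acting on row
    vectors: [nabla_(d_i) Y = d_i Y + Y *m connection i]. Identities between
    Christoffel symbols then become identities between matrices, in which no
    index is contracted explicitly. *)
Definition connection (i : 'I_m) (p : M) : 'M[R]_m :=
  \matrix_(j, k) christoffel g c k i j p.

Lemma smx_connection i : smx c O (connection i).
Proof.
move=> j k; apply: (sm_eq oO Oc (s := fun q => 2^-1 *
   \sum_l invmx (G q) k l *
    (pd c i (fun q => G q j l) q + pd c j (fun q => G q i l) q
     - pd c l (fun q => G q i j) q))).
  by move=> q _; rewrite mxE.
have CG := smx_metric.
have dG a b r : sm (pd c a (fun q => G q b r)) by exact: sm_pd.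
apply: (smM oO Oc); first exact: sm_cst.
apply: (sm_sum oO Oc) => l; apply: (smM oO Oc).
  by apply: (smx_inv oO Oc CG) => q /Oc; exact: metric_unit.
by apply: (smD oO Oc); [exact: smD|exact: smN].
Qed.

(** The connection is torsion free. *)
Lemma connection_sym i j k p : O p -> connection i p j k = connection j p i k.
Proof.
move=> Op; rewrite !mxE /christoffel; congr (_ * _); apply: eq_bigr => l _.
congr (_ * _).
rewrite [X in _ - X](pd_eq oO Oc l (t := fun q => G q j i) Op); first ring.
by move=> q /Oc; exact: metric_sym.
Qed.

Lemma connection_metricE i p j k : O p ->
  (connection i p *m G p) j k = 2^-1 * (pd c i (fun q => G q j k) p
    + pd c j (fun q => G q i k) p - pd c k (fun q => G q i j) p).
Proof.
move=> Op; rewrite mxE.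
pose f l := pd c i (fun q => G q j l) p + pd c j (fun q => G q i l) p
    - pd c l (fun q => G q i j) p.
transitivity (\sum_r \sum_l 2^-1 * (f l * (G p k r * invmx (G p) r l))).
  apply: eq_bigr => r _; rewrite mxE /christoffel mulr_sumr mulr_suml.
  apply: eq_bigr => l _; rewrite -/(f l) (metric_sym r k (Oc Op)); ring.
rewrite exchange_big /=; under eq_bigr do rewrite -2!mulr_sumr.
have GV l : \sum_r G p k r * invmx (G p) r l = (k == l)%:R.
  have := mulmxV (metric_unit (Oc Op)).
  by move=> /matrixP/(_ k l); rewrite mxE => ->; rewrite mxE.
under eq_bigr do rewrite GV.
rewrite -mulr_sumr; congr (_ * _).
rewrite (bigD1 k) //= eqxx mulr1 big1 ?addr0 // => l /negbTE lk.
by rewrite eq_sym lk mulr0.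
Qed.

(** The metric is parallel. *)
Lemma metric_parallel i p : O p ->
  dm c i G p = connection i p *m G p + (connection i p *m G p)^T.
Proof.
move=> Op; apply/matrixP => j k.
rewrite addmxE [_^T _ _]mxE !connection_metricE // mxE.
have S a r l : pd c a (fun q => G q r l) p = pd c a (fun q => G q l r) p.
  by apply: (pd_eq oO Oc) => // q /Oc; exact: metric_sym.
rewrite (S i k j) (S k i j) (S j i k).
by field.
Qed.

(** The order of the products is reversed with respect to the usual formula
    because endomorphisms act on row vectors from the right. *)
Definition curvature (i j : 'I_m) (p : M) : 'M[R]_m :=
  dm c i (connection j) p - dm c j (connection i) p
  + (connection j p *m connection i p - connection i p *m connection j p).

Lemma curvatureE i j k l p : curvature i j p k l = riemann g c l k i j p.
Proof.
have E a b : pd c a (fun q => connection b q k l) p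
    = pd c a (christoffel g c l b k) p.
  by congr (pd c a _ p); apply/funext => q; rewrite mxE.
rewrite !addmxE !oppmxE /riemann; congr (_ + _).
  by congr (_ - _); rewrite dmE; exact: E.
rewrite ![in LHS]mxE -sumrB; apply: eq_bigr => r _; rewrite !mxE.
by rewrite [X in X - _]mulrC [X in _ - X]mulrC.
Qed.

(** The Ricci curvature as the trace of a curvature endomorphism, in the form in
    which it can be computed from [curvature]. *)
Lemma ricciE p (u v : 'rV[R]_m) :
  inner (ricci g c p) u v = \sum_i \sum_j u 0 j * (v *m curvature i j p) 0 i.
Proof.
rewrite /inner mxE exchange_big /=.
transitivity (\sum_k \sum_j u 0 j * v 0 k * ricci g c p j k).
  apply: eq_bigr => k _; rewrite [v^T _ _]mxE mxE mulr_suml.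
  by apply: eq_bigr => j _; ring.
rewrite exchange_big; apply: eq_bigr => j _ /=.
rewrite -mulr_sumr.
under eq_bigr => k _ do rewrite -mulrA.
rewrite -mulr_sumr; congr (_ * _).
under [RHS]eq_bigr do rewrite mxE.
rewrite exchange_big; apply: eq_bigr => k _ /=.
rewrite mxE mulr_sumr; apply: eq_bigr => i _.
by rewrite curvatureE.
Qed.

(** The second derivatives of [g] commute; writing each first derivative with
    [metric_parallel] turns this into the skew symmetry of the curvature with
    lowered indices. *)
Lemma curvature_skew i j p : O p ->
  (curvature i j p *m G p)^T = - (curvature i j p *m G p).
Proof.
move=> Op.
have CG := smx_metric; have CA := smx_connection.
have dd a b : dm c a (dm c b G) p =
   (dm c a (connection b) p *m G p
     + connection b p *m (connection a p *m G p + (connection a p *m G p)^T))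
   + (dm c a (connection b) p *m G p
     + connection b p *m (connection a p *m G p + (connection a p *m G p)^T))^T.
  rewrite (dm_eq oO Oc _ Op (metric_parallel b)).
  have CAG : smx c O (fun q => connection b q *m G q) by exact: smxM.
  rewrite (dmD oO Oc) //; last exact: smxT.
  by rewrite dmT (dmM oO Oc) // -metric_parallel.
have := etrans (esym (dd i j)) (etrans (dm_comm oO Oc i j Op CG) (dd j i)).
rewrite /curvature; move: (dm c i (connection j) p) (dm c j (connection i) p).
move: (connection i p) (connection j p) (gcomp_sym g (Oc Op)).
move: (G p) => {dd CG CA} S A B symS dA dB.
rewrite !(mulmxDr, mulmxDl, mulNmx, mulmxN, trmxD, trmxN, trmx_mul, trmxK) symS.
rewrite !(mulmxN, mulmxA) => /matrixP E; apply/matrixP => a b.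
have := E a b; rewrite !(addmxE, oppmxE) => Eab.
lra.
Qed.

End LeviCivita.

(** * Changes of charts *)

Section Transition.
Variables (R : realType) (m : nat) (M : manifold R m).
Implicit Types (c : Defs.index M) (p q : M) (O : set M).

Lemma open_dom c : open (dom c). Proof. exact: cdom_open. Qed.

Lemma transitionE c c' p i j : dom c p -> dom c' p ->
  transition c c' p i j = pd c i (fun q => coord c' q 0 j) p.
Proof.
move=> cp c'p.
pose O := dom c `&` dom c'.
have oO : open O by apply: openI; exact: open_dom.
have Oc : O `<=` dom c by move=> q [].
have Oc' : O `<=` dom c' by move=> q [].
apply: (@differentialE _ _ _ M M idfun c c' O oO Oc) => [a|]; last by split.
exact: sm_coord_change.
Qed.

Lemma transition_id c p : dom c p -> transition c c p = 1%:M.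
Proof.
move=> cp; apply/matrixP => i j; rewrite transitionE // [RHS]mxE /pd.
rewrite (partial_eq (U := coord c @` dom c) (g := fun x : 'rV[R]_m => x 0 j)).
- exact: partial_coord.
- exact: open_coord_image (@open_dom c) _.
- by exists p.
- by move=> _ [q cq <-] /=; rewrite coordK.
Qed.

Lemma transition_comp c c' c'' p : dom c p -> dom c' p -> dom c'' p ->
  transition c c'' p = transition c c' p *m transition c' c'' p.
Proof.
move=> cp c'p c''p.
pose O := dom c `&` dom c' `&` dom c''.
have oO : open O by do 2?[apply: openI]; exact: open_dom.
have Oc : O `<=` dom c by move=> q [[]].
have Oc' : O `<=` dom c' by move=> q [[]].
have Oc'' : O `<=` dom c'' by move=> q [[]].
apply: (@differential_comp _ _ _ _ M M M idfun idfun c c' c'' O O p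
  oO Oc oO Oc') => [//|a|a|]; do ?exact: sm_coord_change.
by split.
Qed.

Lemma transitionK c c' p : dom c p -> dom c' p ->
  transition c c' p *m transition c' c p = 1%:M.
Proof. by move=> cp c'p; rewrite -transition_comp // transition_id. Qed.

Lemma smx_transition c c' O : open O -> O `<=` dom c -> O `<=` dom c' ->
  smx c O (transition c c').
Proof.
move=> oO Oc Oc' i j.
apply: (sm_eq oO Oc (s := pd c i (fun q => coord c' q 0 j))).
  by move=> q Oq; rewrite transitionE //; [exact: Oc|exact: Oc'].
by apply: sm_pd => //; exact: sm_coord_change.
Qed.

(** The derivative of a Jacobian matrix consists of second derivatives, hence
    is symmetric in its two lower indices. *)
Lemma dm_transition_sym c c' i k j p : dom c p -> dom c' p ->
  dm c i (transition c c') p k j = dm c k (transition c c') p i j.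
Proof.
move=> cp c'p; pose O := dom c `&` dom c'.
have oO : open O by apply: openI; exact: open_dom.
have Oc : O `<=` dom c by move=> q [].
have Oc' : O `<=` dom c' by move=> q [].
have E a b : dm c a (transition c c') p b j
    = pd c a (pd c b (fun q => coord c' q 0 j)) p.
  rewrite dmE; apply: (pd_eq oO Oc); first by split.
  by move=> q [qc qc']; rewrite transitionE.
apply: (etrans (E i k)); apply: etrans (esym (E k i)).
apply: (pd_comm oO Oc); first by split.
exact: sm_coord_change.
Qed.

End Transition.

Section MapDerivative.
Variables (R : realType) (m n : nat) (M : manifold R m) (N : manifold R n).
Variables (F : M -> N) (c : Defs.index M) (d : Defs.index N).
Variables (O : set M) (V : set N).
Hypotheses (oO : open O) (Oc : O `<=` dom c).
Hypotheses (oV : open V) (Vd : V `<=` dom d) (FOV : forall q, O q -> V (F q)).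
Hypothesis smF : forall a, smooth_within c O (fun q => coord d (F q) 0 a).

Lemma smx_differential : smx c O (differential F c d).
Proof.
move=> i a; apply: (sm_eq oO Oc (s := pd c i (fun q => coord d (F q) 0 a))).
  by move=> q Oq; rewrite (differentialE oO Oc smF).
by apply: sm_pd.
Qed.

Lemma smx_comp k l (X : N -> 'M[R]_(k, l)) : smx d V X -> smx c O (X \o F).
Proof. by move=> CX a b; exact: (sm_comp oO Oc oV Vd FOV smF (CX a b)). Qed.

(** The chain rule for a geometric object of the base pulled back by [F]. *)
Lemma dm_comp i k l (X : N -> 'M[R]_(k, l)) p : O p -> smx d V X ->
  dm c i (X \o F) p = \sum_a differential F c d p i a *: dm d a X (F p).
Proof.
move=> Op CX; apply/matrixP => a b; rewrite dmE summxE.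
rewrite (pd_comp oO Oc oV Vd FOV smF i Op (CX a b)).
by apply: eq_bigr => e _; rewrite scalemxE dmE.
Qed.

Lemma dm_differential_sym i k a p : O p ->
  dm c i (differential F c d) p k a = dm c k (differential F c d) p i a.
Proof.
move=> Op.
have E u v : dm c u (differential F c d) p v a
    = pd c u (pd c v (fun q => coord d (F q) 0 a)) p.
  rewrite dmE; apply: (pd_eq oO Oc) => // q Oq.
  exact: (differentialE oO Oc smF).
apply: (etrans (E i k)); apply: etrans (esym (E k i)).
exact: (pd_comm oO Oc).
Qed.

End MapDerivative.

Section LieDerivative.
Variables (R : realType) (m : nat) (M : manifold R m).
Variables (xi : vector_field M) (g : metric M).

Definition field_jacobian (c : Defs.index M) (p : M) : 'M[R]_m :=
  \matrix_(i, k) pd c i (fun q => xi c q 0 k) p.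

Lemma lie_metricE c p : dom c p -> lie_metric xi g c p =
  \sum_k xi c p 0 k *: dm c k (g c) p
  + (field_jacobian c p *m g c p + (field_jacobian c p *m g c p)^T).
Proof.
move=> cp; apply/matrixP => i j; rewrite [LHS]mxE !addmxE summxE.
rewrite [_^T i j]mxE ![(_ *m _) _ _]mxE -!big_split /=.
apply: eq_bigr => k _; rewrite scalemxE dmE.
rewrite ![field_jacobian _ _ _ _]mxE (metric_sym g i k cp); ring.
Qed.

(** The Lie derivative of a metric is a tensor: the second derivatives of the
    change of coordinates cancel. *)
Lemma lie_metric_change c c' p : dom c p -> dom c' p ->
  lie_metric xi g c p
  = transition c c' p *m lie_metric xi g c' p *m (transition c c' p)^T.
Proof.
move=> cp c'p; pose O := dom c `&` dom c'.
have oO : open O by apply: openI; exact: open_dom.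
have Oc : O `<=` dom c by move=> q [].
have Oc' : O `<=` dom c' by move=> q [].
have Op : O p by split.
have smId : forall a, smooth_within c O (fun q : M => coord c' (idfun q) 0 a).
  by move=> a; exact: sm_coord_change.
pose J := transition c c'.
have CJ : smx c O J by exact: smx_transition.
have CG' : smx c' O (g c') by exact: smx_metric.
have CG'c : smx c O (g c').
  exact: (smx_comp (F := idfun) oO Oc oO Oc' (fun q => id) smId CG').
have CZ k : smooth_within c O (fun q => xi c q 0 k).
  by apply: (sm_sub Oc); exact: vcomp_smooth.
have CZ' k : smooth_within c' O (fun q => xi c' q 0 k).
  by apply: (sm_sub Oc'); exact: vcomp_smooth.
rewrite !lie_metricE //.
set S' := \sum_k xi c' p 0 k *: _.
set A := field_jacobian c p; set A' := field_jacobian c' p.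
pose P : 'M[R]_m := \sum_k xi c p 0 k *: dm c k J p.
have dG k : dm c k (g c) p = dm c k J p *m g c' p *m (J p)^T
    + J p *m dm c k (g c') p *m (J p)^T
    + J p *m g c' p *m (dm c k J p)^T.
  rewrite (dm_eq oO Oc k (Y := fun q => J q *m g c' q *m (J q)^T) Op); last first.
    by move=> q [qc qc']; exact: gcomp_change.
  have CJG : smx c O (fun q => J q *m g c' q) by exact: smxM.
  rewrite (dmM oO Oc k Op CJG (smxT oO Oc CJ)) (dmM oO Oc k Op CJ CG'c) dmT.
  by rewrite mulmxDl.
have dG' k : dm c k (g c') p = \sum_l J p k l *: dm c' l (g c') p.
  exact: (dm_comp (F := idfun) oO Oc oO Oc' (fun q => id) smId k Op CG').
have SE : \sum_k xi c p 0 k *: dm c k (g c) p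
    = P *m g c' p *m (J p)^T + J p *m S' *m (J p)^T + J p *m g c' p *m P^T.
  have ZdG' : \sum_k xi c p 0 k *: dm c k (g c') p = S'.
    rewrite /S' (vcomp_change xi cp c'p) -/(J p).
    under eq_bigr do rewrite dG' scaler_sumr.
    rewrite exchange_big; apply: eq_bigr => l _.
    rewrite [(_ *m _) _ _]mxE scaler_suml; apply: eq_bigr => k _.
    by rewrite scalerA.
  have -> : \sum_k xi c p 0 k *: dm c k (g c) p =
     \sum_k (xi c p 0 k *: dm c k J p *m g c' p *m (J p)^T
      + J p *m (xi c p 0 k *: dm c k (g c') p) *m (J p)^T
      + J p *m g c' p *m (xi c p 0 k *: dm c k J p)^T).
    apply: eq_bigr => k _; rewrite dG !scalerDr.
    by rewrite -!scalemxAl -!scalemxAr -!scalemxAl linearZ /= -scalemxAr.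
  rewrite !big_split /= -!mulmx_suml -mulmx_sumr -ZdG'.
  congr (_ + _); rewrite -mulmx_sumr; congr (_ *m _).
  by rewrite /P linear_sum.
have AJ : A *m J p = J p *m A' - P.
  apply/matrixP => i j; rewrite addmxE oppmxE ![(_ *m _) _ _]mxE summxE.
  have E1 : pd c i (fun q => xi c' q 0 j) p = \sum_l J p i l * A' l j.
    have := pd_comp (F := idfun) oO Oc oO Oc' (fun q => id) smId i Op (CZ' j).
    move=> /= ->; apply: eq_bigr => l _.
    by rewrite [A' l j]mxE.
  have E2 : pd c i (fun q => xi c' q 0 j) p
     = \sum_k A i k * J p k j + \sum_k (xi c p 0 k *: dm c k J p) i j.
    rewrite (pd_eq oO Oc i (t := fun q => \sum_k xi c q 0 k * J q k j) Op).
      rewrite (pd_sum oO Oc) // -?big_split; last first.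
        by move=> k; exact: (smM oO Oc (CZ k) (CJ k j)).
      apply: eq_bigr => k _.
      rewrite (pdM oO Oc i Op (CZ k) (CJ k j)) scalemxE.
      by rewrite (dm_transition_sym k i j cp c'p) [A i k]mxE dmE.
    by move=> q [qc qc']; rewrite (vcomp_change xi qc qc') [LHS]mxE.
  by rewrite -E1 E2 addrK.
rewrite SE (gcomp_change g cp c'p) -/(J p) !mulmxA AJ.
have alg (K G Q S B : 'M[R]_m) : G^T = G ->
  Q *m G *m K^T + K *m S *m K^T + K *m G *m Q^T
    + ((K *m B - Q) *m G *m K^T + ((K *m B - Q) *m G *m K^T)^T)
  = K *m (S + (B *m G + (B *m G)^T)) *m K^T.
  move=> symG.
  rewrite !(mulmxDl, mulmxDr, mulNmx, mulmxN, trmxD, trmxN, trmx_mul, trmxK).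
  by rewrite symG !mulmxA; mx_linear.
exact: alg (gcomp_sym g c'p).
Qed.

End LieDerivative.

(** * Localised vector fields *)

Section LocalizedField.
Variables (R : realType) (m : nat) (M : manifold R m).

(** Every smooth local vector field is, up to a factor which does not vanish at
    a given point, the restriction of a global one: multiply it by a bump
    function whose support is compact inside [O], and extend by 0. Compact
    sets of a Hausdorff space being closed, the extension is smooth. The
    condition that the fibers be totally geodesic speaks of global fields only. *)
Lemma localized_field (c : Defs.index M) (O : set M) (w : M -> 'rV[R]_m) (p : M) :
  open O -> O `<=` dom c -> O p -> smx c O w ->
  exists (X : vector_field M) (kappa : M -> R),
    [/\ smooth_within c O kappa, kappa p != 0,
        forall c' q, dom c' q -> O q ->
          X c' q = kappa q *: (w q *m transition c c' q) &
        forall c' q, dom c' q -> ~ O q -> X c' q = 0].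
Proof.
move=> oO Oc Op Cw.
have oI := open_coord_image oO Oc.
have Ip : (coord c @` O) (coord c p) by exists p.
have NI : nbhs (coord c p) (coord c @` O) by exact: open_nbhs_nbhs.
move/nbhs_closedballP : NI => [rp BO].
have : 0 < rp%:num by [].
move: (rp%:num) BO => r BO r0.
pose B := closed_ball (coord c p) r.
pose K : set M := param c @` B.
have KO : K `<=` O.
  by move=> _ [x /BO [q Oq <-] <-]; rewrite coordK //; exact: Oc.
have KE x : B x -> `|coord c p - x| <= r.
  by rewrite /B closed_ballE.
have cB : compact B.
  apply: bounded_closed_compact; last exact: closed_ball_closed.
  exists (`|coord c p| + r); split; first exact: num_real.
  move=> s rs x /KE xr /=.
  apply: le_trans (ltW rs); rewrite -[x](subrK (coord c p)).
  by apply: (le_trans (ler_normD _ _)); rewrite addrC lerD2l distrC.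
have cK : closed K.
  apply: compact_closed; first exact: carrier_hausdorff.
  apply: continuous_compact => //; apply: continuous_in_subspaceT => x.
  rewrite inE => /BO [q Oq <-].
  apply: (cinv_continuous (c := atlas M c)); rewrite inE.
  by exists q; [exact: (Oc q Oq)|].
pose kappa q := bump (coord c p) r (coord c q).
have kappa0 q : O q -> ~ K q -> kappa q = 0.
  move=> Oq nK; apply: bump_support => // Bq; apply: nK.
  exists (coord c q); last by rewrite coordK //; exact: Oc.
  exact: (@subset_closed_ball _ _ (coord c p) r).
have Ckappa : smooth_within c O kappa.
  move=> k; apply: (C_on_eq oI (f := bump (coord c p) r)).
    by move=> _ [q Oq <-]; rewrite /= /kappa coordK //; exact: Oc.
  exact: smooth_bump.
pose X (c' : Defs.index M) q : 'rV[R]_m :=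
  if pselect (O q) then kappa q *: (w q *m transition c c' q) else 0.
have XO c' q : O q -> X c' q = kappa q *: (w q *m transition c c' q).
  by move=> Oq; rewrite /X; case: pselect.
have X0 c' q : ~ O q -> X c' q = 0.
  by move=> Oq; rewrite /X; case: pselect.
have X_smooth c' i : smooth_in_chart c' (fun q => X c' q 0 i).
  apply: sm_local => q c'q.
  have [Oq|nOq] := pselect (O q).
    pose U := O `&` dom c'.
    have oU : open U by apply: openI => //; exact: open_dom.
    have Uc : U `<=` dom c by move=> s [/Oc].
    have Uc' : U `<=` dom c' by move=> s [].
    have UO : U `<=` O by move=> s [].
    exists U; split=> //.
    apply: (sm_change oU Uc Uc').
    apply: (sm_eq oU Uc (s := fun s => (kappa s *: (w s *m transition c c' s)) 0 i)).
      by move=> s [Os _]; rewrite XO.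
    apply: (smxZ oU Uc); first exact: sm_sub Ckappa.
    apply: (smxM oU Uc); last exact: smx_transition.
    by move=> a b; apply: sm_sub (Cw a b).
  pose U := ~` K `&` dom c'.
  have oU : open U by apply: openI; [exact: closed_openC|exact: open_dom].
  have Uc' : U `<=` dom c' by move=> s [].
  exists U; split=> //; first by split=> // /KO.
  apply: (sm_eq oU Uc' (s := fun=> 0)); last exact: sm_cst.
  move=> s [nK _]; have [Os|nOs] := pselect (O s).
    by rewrite XO // kappa0 // scale0r mxE.
  by rewrite X0 // mxE.
have X_change c1 c2 q : dom c1 q -> dom c2 q ->
    X c2 q = X c1 q *m transition c1 c2 q.
  move=> q1 q2; have [Oq|nOq] := pselect (O q); last by rewrite !X0 // mul0mx.
  by rewrite !XO // -scalemxAl -mulmxA -transition_comp //; exact: Oc.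
exists (VectorField X_smooth X_change), kappa; split=> //.
- exact: bump_center.
- by move=> c' q _; exact: XO.
- by move=> c' q _; exact: X0.
Qed.

End LocalizedField.

(** * Horizontal lifts *)

Lemma innerE (R : realType) m (A : 'M[R]_m) (u v : 'rV[R]_m) :
  inner A u v = 0 <-> u *m A *m v^T = 0.
Proof.
rewrite /inner; split=> [E|->]; last by rewrite mxE.
by apply/matrixP => i j; rewrite (ord1 i) (ord1 j) E mxE.
Qed.

Lemma eq_bilinear_mx (R : realType) k l (A B : 'M[R]_(k, l)) :
  (forall (t : 'rV[R]_k) (t' : 'rV[R]_l),
    (t *m A *m t'^T) 0 0 = (t *m B *m t'^T) 0 0) -> A = B.
Proof.
have E (C : 'M[R]_(k, l)) a b :
    C a b = ((delta_mx 0 a : 'rV[R]_k) *m C *m (delta_mx 0 b : 'rV[R]_l)^T) 0 0.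
  by rewrite -rowE trmx_delta -colE !mxE.
by move=> AB; apply/matrixP => a b; rewrite E AB -E.
Qed.

Section HorizontalLift.
Variables (R : realType) (m n : nat) (M : manifold R m) (N : manifold R n).
Variables (g : metric M) (h : metric N) (F : M -> N) (lambda : M -> R).
Hypothesis conformalF : conformal_submersion g h F lambda.
Variables (c : Defs.index M) (d : Defs.index N).

(** The points where [F] can be read in the charts [c] and [d]. *)
Definition chart_region : set M := dom c `&` F @^-1` dom d.

Local Notation O := chart_region.
Local Notation D := (differential F c d).
Local Notation G := (g c).
Local Notation H := (fun q => h d (F q)).

Definition inv_sqr_dilation (q : M) : R := (lambda q)^-1 * (lambda q)^-1.

Local Notation rho := inv_sqr_dilation.

(** The rows are the horizontal lifts of the coordinate fields of the base: they
    are the gradients of the components of [F], with the index lowered by the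
    metric of the base, and normalised by the dilation. The matrix [D *m L] is therefore the
    orthogonal projection onto the horizontal distribution. *)
Definition lift_matrix (q : M) : 'M[R]_(n, m) :=
  rho q *: (H q *m (D q)^T *m invmx (G q)).

Local Notation L := lift_matrix.

Lemma open_chart_region : open O.
Proof.
have [[[cF _] _] _ _ _ _] := conformalF.
apply: openI; first exact: open_dom.
by move/continuousP: cF; apply; exact: open_dom.
Qed.

Lemma chart_region_dom : O `<=` dom c. Proof. by move=> q []. Qed.

Lemma chart_region_img q : O q -> dom d (F q). Proof. by case. Qed.

Let oO := open_chart_region.
Let Oc := chart_region_dom.
Let od : open (dom d) := @open_dom _ _ N d.

Lemma sm_map a : smooth_within c O (fun q => coord d (F q) 0 a).
Proof. by have [[[_ smF] _] _ _ _ _] := conformalF; exact: smF. Qed.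

Lemma sm_lambda : smooth_within c O lambda.
Proof.
have [_ _ Cl _ _] := conformalF.
by apply: (sm_sub Oc); exact: Cl.
Qed.

Lemma lambda_neq0 q : lambda q != 0.
Proof. by have [_ _ _ l0 _] := conformalF; rewrite gt_eqF. Qed.

Lemma inv_sqr_dilation_neq0 q : rho q != 0.
Proof. by rewrite mulf_neq0 // invr_neq0 // lambda_neq0. Qed.

Lemma sm_inv_sqr_dilation : smooth_within c O rho.
Proof.
have Cl := smV oO Oc sm_lambda (fun q _ => lambda_neq0 q).
exact: smM.
Qed.

Lemma smx_D : smx c O D.
Proof. exact: smx_differential oO Oc sm_map. Qed.

Lemma smx_Ginv : smx c O (fun q => invmx (G q)).
Proof.
apply: (smx_inv oO Oc (smx_metric g Oc)) => q Oq.
exact: metric_unit (Oc Oq).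
Qed.

Lemma smx_H : smx c O H.
Proof.
apply: (smx_comp (X := h d) oO Oc od (fun q => id) chart_region_img sm_map).
exact: smx_metric.
Qed.

Lemma smx_lift : smx c O L.
Proof.
apply: (smxZ oO Oc sm_inv_sqr_dilation).
apply: (smxM oO Oc _ smx_Ginv); apply: (smxM oO Oc smx_H).
exact: (smxT oO Oc smx_D).
Qed.

(** The definition quantifies over all charts of the base around [F q]; a change
    of charts multiplies the differential by an invertible matrix, and one
    chart is enough. *)
Lemma vertical_chart q v : O q -> (vertical F c q v <-> v *m D q = 0).
Proof.
move=> Oq; split=> [vv|vD d' d'Fq]; first exact: vv (chart_region_img Oq).
pose U := O `&` F @^-1` dom d'.
pose V := dom d `&` dom d'.
have oU : open U.
  apply: openI => //; have [[[cF _] _] _ _ _ _] := conformalF.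
  by move/continuousP: cF; apply; exact: open_dom.
have Uc : U `<=` dom c by move=> s [/Oc].
have oV : open V by apply: openI; exact: open_dom.
have Vd : V `<=` dom d by move=> s [].
have Vd' : V `<=` dom d' by move=> s [].
have UV s : U s -> V (F s) by move=> [[_ ds] d's]; split.
have CU a : smooth_within c U (fun q => coord d (F q) 0 a).
  by apply: (sm_sub (O := O)) (sm_map a) => s [].
have CV a : smooth_within d V (fun q : N => coord d' (idfun q) 0 a).
  exact: sm_coord_change.
have -> : differential F c d' q = D q *m transition d d' (F q).
  exact: (differential_comp (G := idfun) oU Uc oV Vd UV CU CV).
by rewrite mulmxA vD mul0mx.
Qed.

Lemma lift_metric q : O q -> L q *m G q = rho q *: (H q *m (D q)^T).
Proof.
move=> Oq; rewrite /lift_matrix -scalemxAl -mulmxA mulVmx ?mulmx1 //.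
exact: metric_unit (Oc Oq).
Qed.

Lemma base_metric_sym q : O q -> (H q)^T = H q.
Proof. by move=> /chart_region_img; exact: gcomp_sym. Qed.

Lemma invmx_metric_sym q : O q -> (invmx (G q))^T = invmx (G q).
Proof. by move=> /Oc cq; rewrite trmx_inv (gcomp_sym g cq). Qed.

(** Conformality on the horizontal vectors [t *m D^T *m G^-1] says that
    [Q = D^T G^-1 D] satisfies [Q H Q = lambda^2 Q]; and [Q] is invertible as
    [F] is a submersion and [g] is definite. *)
Lemma lift_differential q : O q -> L q *m D q = 1%:M.
Proof.
move=> Oq; have [[_ fullD] _ _ _ confF] := conformalF.
have uG := metric_unit g (Oc Oq).
pose Q := (D q)^T *m invmx (G q) *m D q.
have symGV := invmx_metric_sym Oq.
pose v (t : 'rV[R]_n) := t *m ((D q)^T *m invmx (G q)).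
have vG t : v t *m G q = t *m (D q)^T by rewrite /v -!mulmxA mulVmx // mulmx1.
have hv t : horizontal g F c q (v t).
  move=> u /(vertical_chart _ Oq) uD; apply/innerE.
  by rewrite vG -mulmxA -trmx_mul uD trmx0 mulmx0.
have vD t : v t *m D q = t *m Q by rewrite /v /Q !mulmxA.
have QHQ : Q *m H q *m Q = (lambda q ^+ 2) *: Q.
  have symQ : Q^T = Q by rewrite /Q !trmx_mul trmxK symGV mulmxA.
  apply: eq_bilinear_mx => t t'.
  have := confF c d q (Oc Oq) (chart_region_img Oq) _ _ (hv t) (hv t').
  rewrite /inner !vD vG trmx_mul symQ !mulmxA => ->.
  rewrite -scalemxAr -scalemxAl scalemxE; congr (_ * _).
  by rewrite /Q /v !trmx_mul trmxK symGV !mulmxA.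
have uQ : Q \in unitmx.
  rewrite -row_free_unit; apply: inj_row_free => t tQ.
  have v0 : v t = 0.
    apply/eqP; apply: contraT => vn0.
    have := gcomp_pos g (Oc Oq) vn0; rewrite /inner vG.
    by rewrite -mulmxA -trmx_mul vD tQ trmx0 mulmx0 mxE ltxx.
  have tD : t *m (D q)^T = 0 by rewrite -vG v0 mul0mx.
  have := fullD c d q (Oc Oq) (chart_region_img Oq).
  move=> /row_fullP[B BD].
  by rewrite -[t]mulmx1 -trmx1 -BD trmx_mul mulmxA tD mul0mx.
have HQ : H q *m Q = (lambda q ^+ 2) *: 1%:M.
  by rewrite -[LHS](mulKmx uQ) [Q *m (_ *m _)]mulmxA QHQ -scalemxAr mulVmx.
rewrite /lift_matrix -scalemxAl -!mulmxA [(D q)^T *m _]mulmxA HQ scalerA.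
rewrite /inv_sqr_dilation expr2 mulrACA mulVf ?lambda_neq0 // mulr1.
by rewrite scale1r.
Qed.

(** Horizontal vectors are the fixed points of the projection [D *m L]: the
    difference of a horizontal vector and its projection is both horizontal
    and vertical. *)
Lemma horizontal_chart q v : O q ->
  (horizontal g F c q v <-> v = v *m D q *m L q).
Proof.
move=> Oq; have LD := lift_differential Oq.
have ortho t u : u *m D q = 0 -> t *m L q *m G q *m u^T = 0.
  move=> uD; rewrite -mulmxA -[t *m _ *m _]mulmxA [L q *m _]mulmxA.
  rewrite lift_metric // -scalemxAl -mulmxA -trmx_mul uD.
  by rewrite trmx0 mulmx0 scaler0 mulmx0.
split=> [hv|-> u /(vertical_chart _ Oq) uD]; last first.
  by apply/innerE; exact: ortho.
set w := v *m D q *m L q; pose u := v - w.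
have uD : u *m D q = 0.
  by rewrite /u mulmxBl /w -[X in _ - X]mulmxA LD mulmx1 subrr.
have : u *m G q *m u^T = 0.
  rewrite {1}/u 2!mulmxBl [w *m _ *m _]ortho // subr0.
  by apply/innerE/hv/(vertical_chart _ Oq).
move=> /(innerE (G q) u u) uu.
have [/eqP|u0] := eqVneq u 0; first by rewrite subr_eq0 => /eqP.
by have := gcomp_pos g (Oc Oq) u0; rewrite uu ltxx.
Qed.

End HorizontalLift.

(** * Integrable distributions *)

Section Integrability.
Variables (R : realType) (m r : nat) (M : manifold R m).
Variables (Dist : distribution M) (c : Defs.index M) (O : set M).
Hypotheses (oO : open O) (Oc : O `<=` dom c).
Hypothesis integrableD : integrable_distribution r Dist.

(** The form [omega] vanishes on the integral manifolds of the distribution,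
    hence so does its exterior derivative, which is given by the skew part of the
    matrix below. *)
Lemma annihilator_closed (omega : M -> 'rV[R]_m) p (u v : 'rV[R]_m) :
  smx c O omega ->
  (forall q w, O q -> Dist c q w -> omega q *m w^T = 0) -> O p ->
  Dist c p u -> Dist c p v ->
  u *m (\matrix_(k, j) pd c k (fun q => omega q 0 j) p) *m v^T
  = v *m (\matrix_(k, j) pd c k (fun q => omega q 0 j) p) *m u^T.
Proof.
move=> Comega omega0 Op Du Dv.
have [W [s [oW [x0 Wx0 sx0] cs smooth_s tangent]]] := integrableD p.
pose W' := W `&` s @^-1` O.
have oW' : open W'.
  rewrite openE => x [Wx Osx].
  have N1 : nbhs x W by exact: open_nbhs_nbhs.
  have N2 : nbhs x (s @^-1` O).
    by apply: (cs x); rewrite ?inE //; exact: open_nbhs_nbhs.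
  exact: filterI N1 N2.
have W'x0 : W' x0 by split=> //=; rewrite sx0.
have Cs j : smooth_on W' (fun x => coord c (s x) 0 j).
  move=> k; apply: C_on_sub (smooth_s c j k) => x [Wx Osx]; split=> //.
  exact: (Oc Osx).
have ds x j : W' x -> differentiable (fun x => coord c (s x) 0 j) x.
  by move=> W'x; exact: (C_on_differentiable oW' (Cs j 1%N) W'x).
pose J x := 'J (coord c \o s) x.
have JE x a j : W' x -> J x a j = partial a (fun x => coord c (s x) 0 j) x.
  by move=> W'x; apply: jacobianE => i; exact: ds.
have vanish x a : W' x ->
    \sum_j omega (s x) 0 j * partial a (fun x => coord c (s x) 0 j) x = 0.
  move=> W'x; have [Wx Osx] := W'x.
  have [_ tanE] := tangent c x Wx (Oc Osx).
  have Drow : Dist c (s x) ((delta_mx 0 a : 'rV[R]_r) *m J x).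
    by apply/tanE; exists (delta_mx 0 a).
  have := omega0 _ _ Osx Drow; rewrite -rowE => /matrixP/(_ 0 0).
  rewrite [LHS]mxE [RHS]mxE => E; rewrite -[RHS]E; apply: eq_bigr => j _.
  have -> : (row a (J x))^T j 0 = J x a j by rewrite [LHS]mxE [LHS]mxE.
  by rewrite JE.
pose Om : 'M[R]_m := \matrix_(k, j) pd c k (fun q => omega q 0 j) p.
have domega b j : partial b (fun x => omega (s x) 0 j) x0
    = (J x0 *m Om) b j.
  have Cj : smooth_within c O (fun q => omega q 0 j) by exact: Comega.
  have E : partial b (fun x => omega (s x) 0 j) x0 =
      partial b (((fun q => omega q 0 j) \o param c) \o (coord c \o s)) x0.
    apply: (partial_eq _ oW' W'x0) => x [_ Osx].
    by rewrite /= coordK //; exact: (Oc Osx).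
  rewrite E partial_comp; last 2 first.
  - by move=> i; exact: ds.
  - by rewrite /= sx0; exact: (sm_differentiable oO Oc Cj Op).
  rewrite [RHS]mxE; apply: eq_bigr => k _.
  by rewrite JE // [Om k j]mxE /= sx0.
have sym a b : (J x0 *m Om *m (J x0)^T) b a = (J x0 *m Om *m (J x0)^T) a b.
  have key a' b' : (J x0 *m Om *m (J x0)^T) b' a' =
      - \sum_j omega p 0 j * partial b' (partial a' (fun x => coord c (s x) 0 j)) x0.
    have C1 j : C_on 1 W' (partial a' (fun x => coord c (s x) 0 j)).
      exact: C_on_partial (Cs j 2%N).
    have C2 j : C_on 1 W' (fun x => omega (s x) 0 j).
      apply: (C_on_eq oW' (f := ((fun q => omega q 0 j) \o param c) \o (coord c \o s))).
        move=> x [_ Osx].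
        by rewrite /= coordK //; exact: (Oc Osx).
      apply: (C_on_comp oW' (open_coord_image oO Oc)).
      - by move=> x [_ Osx]; exists (s x).
      - by move=> i; exact: Cs.
      exact: Comega.
    have : partial b' (fun x => \sum_j omega (s x) 0 j
        * partial a' (fun x => coord c (s x) 0 j) x) x0 = 0.
      rewrite (partial_eq _ oW' W'x0 (g := fun=> 0)) ?partial_cst //.
      by move=> x W'x; exact: vanish.
    rewrite /partial.
    have -> : (fun x => \sum_j omega (s x) 0 j
        * 'D_(delta_mx 0 a') (fun x => coord c (s x) 0 j) x)
      = \sum_j (fun x => omega (s x) 0 j
        * 'D_(delta_mx 0 a') (fun x => coord c (s x) 0 j) x).
      by apply/funext => x; rewrite fct_sumE.
    have C3 j : differentiable (fun x => omega (s x) 0 j) x0.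
      exact: (C_on_differentiable oW' (C2 j) W'x0).
    have C4 j : differentiable (partial a' (fun x => coord c (s x) 0 j)) x0.
      exact: (C_on_differentiable oW' (C1 j) W'x0).
    rewrite derive_sum; last first.
      by move=> j; apply: diff_derivable; exact: differentiableM (C3 j) (C4 j).
    move=> E; apply/eqP; rewrite -addr_eq0; apply/eqP; rewrite -[RHS]E.
    rewrite [(_ *m _) _ _]mxE -big_split; apply: eq_bigr => j _ /=.
    have := partialM b' (C3 j) (C4 j); rewrite /partial => ->.
    rewrite -domega [_^T _ _]mxE JE // sx0.
    by [].
  apply: (etrans (key a b)); apply: etrans (esym (key b a)).
  apply: (congr1 (fun z => - z)); apply: eq_bigr => j _.
  apply: (congr1 (fun z => omega p 0 j * z)).
  exact: (partial_comm b a oW' (Cs j 2%N) W'x0).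
have [_ tanE] := tangent c x0 Wx0 (Oc (proj2 W'x0)).
rewrite sx0 in tanE.
have [tu ->] := (tanE u).1 Du; have [tv ->] := (tanE v).1 Dv.
rewrite -/Om -/(J x0) !trmx_mul.
have JOJ : (J x0 *m Om *m (J x0)^T)^T = J x0 *m Om *m (J x0)^T.
  by apply/matrixP => a b; rewrite [LHS]mxE sym.
have E t t' : t *m J x0 *m Om *m ((J x0)^T *m t'^T)
   = t *m (J x0 *m Om *m (J x0)^T) *m t'^T by rewrite !mulmxA.
rewrite !E; apply/matrixP => i j; rewrite (ord1 i) (ord1 j).
set K := J x0 *m Om *m (J x0)^T in JOJ *.
transitivity ((tu *m K *m tv^T)^T 0 0); first by rewrite [RHS]mxE.
by rewrite trmx_mul trmxK trmx_mul JOJ mulmxA.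
Qed.

End Integrability.

(** * The second fundamental form of a conformal submersion *)

Opaque pd dm.

Section SecondFundamentalForm.
Variables (R : realType) (m n : nat) (M : manifold R m) (N : manifold R n).
Variables (g : metric M) (h : metric N) (F : M -> N) (lambda : M -> R).
Hypothesis conformalF : conformal_submersion g h F lambda.
Variables (c : Defs.index M) (d : Defs.index N).

Local Notation O := (chart_region F c d).
Local Notation D := (differential F c d).
Local Notation G := (g c).
Local Notation H := (fun q => h d (F q)).
Local Notation rho := (inv_sqr_dilation lambda).
Local Notation L := (lift_matrix g h F lambda c d).
Local Notation A := (connection g c).

Let oO := open_chart_region conformalF c d.
Let Oc : O `<=` dom c := @chart_region_dom _ _ _ _ _ F c d.
Let od : open (dom d) := @open_dom _ _ N d.
Let Fd q (Oq : O q) : dom d (F q) := chart_region_img Oq.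
Let CF := sm_map conformalF c d.
Let CD := smx_D conformalF c d.
Let CG : smx c O G := smx_metric g Oc.
Let CH := smx_H conformalF c d.
Let CL := smx_lift conformalF c d.

Definition log_dilation_form (q : M) : 'rV[R]_m :=
  (lambda q)^-1 *: \row_i pd c i lambda q.

Local Notation theta := log_dilation_form.

Lemma log_dilation_formE q i : theta q 0 i = (lambda q)^-1 * pd c i lambda q.
Proof. by rewrite scalemxE [X in _ * X]mxE. Qed.

Let sm_inv_lambda : smooth_within c O (fun q => (lambda q)^-1).
Proof.
apply: (smV oO Oc (sm_lambda conformalF c d)) => q _.
exact: (lambda_neq0 conformalF).
Qed.

Lemma smx_log_dilation : smx c O theta.
Proof.
move=> a i; rewrite (ord1 a).
apply: (sm_eq oO Oc (s := fun q => (lambda q)^-1 * pd c i lambda q)).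
  by move=> q _; rewrite log_dilation_formE.
apply: (smM oO Oc sm_inv_lambda).
exact: (sm_pd oO Oc i (sm_lambda conformalF c d)).
Qed.

Lemma log_dilation_closed i j p : O p ->
  dm c i theta p 0 j = dm c j theta p 0 i.
Proof.
move=> Op; have Cl := sm_lambda conformalF c d.
have E a b : dm c a theta p 0 b =
   - pd c a lambda p * (lambda p)^-1 * (lambda p)^-1 * pd c b lambda p
   + (lambda p)^-1 * pd c a (pd c b lambda) p.
  rewrite dmE (pd_eq oO Oc a (t := fun q => (lambda q)^-1 * pd c b lambda q) Op).
    rewrite (pdM oO Oc a Op sm_inv_lambda (sm_pd oO Oc b Cl)).
    by rewrite (pdV oO Oc a Op Cl (lambda_neq0 conformalF p)).
  by move=> q _; exact: log_dilation_formE.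
apply: (etrans (E i j)); apply: etrans (esym (E j i)).
rewrite (pd_comm oO Oc i j Op Cl); ring.
Qed.

Lemma pd_inv_sqr_dilation k p : O p ->
  pd c k rho p = - (2 * theta p 0 k * rho p).
Proof.
move=> Op; rewrite (pdM oO Oc k Op sm_inv_lambda sm_inv_lambda).
rewrite (pdV oO Oc k Op (sm_lambda conformalF c d) (lambda_neq0 conformalF p)).
rewrite log_dilation_formE /inv_sqr_dilation; ring.
Qed.

(** The pull-back by [F] of the Levi-Civita connection of the base, in the
    coordinate direction [i]. *)
Definition base_connection (i : 'I_m) (q : M) : 'M[R]_n :=
  \sum_a D q i a *: connection h d a (F q).

Local Notation B := base_connection.

Lemma smx_base_connection i : smx c O (B i).
Proof.
apply: (smx_sum oO Oc) => a; apply: (smxZ oO Oc); first exact: CD.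
apply: (smx_comp (X := connection h d a) oO Oc od (fun q => id) Fd CF).
exact: (smx_connection h od (fun q => id)).
Qed.

Lemma dm_base_metric i p : O p ->
  dm c i H p = B i p *m H p + (B i p *m H p)^T.
Proof.
move=> Op.
have Ch : smx d (dom d) (h d) by exact: smx_metric.
have := dm_comp oO Oc od (fun q => id) Fd CF i Op Ch.
move=> ->; rewrite /base_connection mulmx_suml linear_sum -big_split.
apply: eq_bigr => a _; rewrite (metric_parallel h od (fun q => id) a (Fd Op)).
by rewrite -scalemxAl [in RHS]linearZ /= scalerDr.
Qed.

(** The second fundamental form [nabla dF]: the row [j] of the matrix of index
    [i] is its value on the coordinate fields [i] and [j]. *)
Definition second_form (i : 'I_m) (q : M) : 'M[R]_(m, n) :=
  dm c i D q - A i q *m D q + D q *m B i q.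

Local Notation S := second_form.

(** Both connections are torsion free and second derivatives commute. *)
Lemma second_form_sym i j a p : O p -> S i p j a = S j p i a.
Proof.
move=> Op; rewrite !addmxE !oppmxE; congr (_ - _ + _).
- exact: (dm_differential_sym oO Oc CF).
- rewrite ![(_ *m _) _ _]mxE; apply: eq_bigr => k _.
  by rewrite (connection_sym g oO Oc i j k Op).
rewrite ![(_ *m _) _ _]mxE.
have E u v : \sum_b D p u b * B v p b a =
    \sum_b \sum_e D p u b * D p v e * connection h d e (F p) b a.
  apply: eq_bigr => b _; rewrite summxE mulr_sumr; apply: eq_bigr => e _.
  by rewrite scalemxE mulrA.
rewrite (E j i) (E i j) exchange_big /=.
apply: eq_bigr => b _; apply: eq_bigr => e _.
rewrite (connection_sym h od (fun q => id) b e a (Fd Op)); ring.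
Qed.

(** The derivative of the conformality relation [L G L^T = rho H]; the terms with
    the two connections disappear because both metrics are parallel. *)
Lemma second_form_conformal k p : O p ->
  L p *m S k p *m H p + (L p *m S k p *m H p)^T
  = (2 * theta p 0 k) *: H p.
Proof.
move=> Op.
have LG q (Oq : O q) := lift_metric g h lambda Oq.
have LD q (Oq : O q) := lift_differential conformalF Oq.
have sG := gcomp_sym g (Oc Op).
have sH := base_metric_sym h Op.
have GL : G p *m (L p)^T = rho p *: (D p *m H p).
  by rewrite -{1}sG -trmx_mul LG // linearZ /= trmx_mul trmxK sH.
have dLD : dm c k L p *m D p = - (L p *m dm c k D p).
  apply/eqP; rewrite -addr_eq0 -(dmM oO Oc k Op CL CD); apply/eqP.
  by rewrite (dm_eq oO Oc k Op LD) dm_cst.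
have dLGL : dm c k (fun q => L q *m G q *m (L q)^T) p
     = dm c k (fun q => rho q *: H q) p.
  apply: (dm_eq oO Oc k Op) => q Oq.
  by rewrite LG // -scalemxAl -mulmxA -trmx_mul LD // trmx1 mulmx1.
have Crho := sm_inv_sqr_dilation conformalF c d.
have CLG : smx c O (fun q => L q *m G q) by exact: smxM.
move: dLGL; rewrite (dmM oO Oc k Op CLG (smxT oO Oc CL)) (dmM oO Oc k Op CL CG).
rewrite dmT (dmZ oO Oc k Op Crho CH) (pd_inv_sqr_dilation k Op).
rewrite (metric_parallel g oO Oc k Op) (dm_base_metric k Op).
rewrite mulmxDl.
have -> : dm c k L p *m G p *m (L p)^T = - rho p *: (L p *m dm c k D p *m H p).
  by rewrite -mulmxA GL -scalemxAr mulmxA dLD mulNmx scalerN scaleNr.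
have -> : L p *m G p *m (dm c k L p)^T = - rho p *: (L p *m dm c k D p *m H p)^T.
  rewrite LG // -scalemxAl -mulmxA -trmx_mul dLD linearN /= mulmxN.
  by rewrite scalerN scaleNr [in RHS]trmx_mul sH.
have -> : L p *m (A k p *m G p + (A k p *m G p)^T) *m (L p)^T
    = rho p *: (L p *m A k p *m D p *m H p + (L p *m A k p *m D p *m H p)^T).
  have E : L p *m (A k p *m G p) *m (L p)^T = rho p *: (L p *m A k p *m D p *m H p).
    by rewrite !mulmxA -mulmxA GL -scalemxAr !mulmxA.
  have E' : L p *m (A k p *m G p)^T *m (L p)^T = (L p *m (A k p *m G p) *m (L p)^T)^T.
    by rewrite !trmx_mul trmxK !mulmxA.
  by rewrite mulmxDr mulmxDl E' E linearZ /= scalerDr.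
have -> : L p *m S k p *m H p = L p *m dm c k D p *m H p
     - L p *m A k p *m D p *m H p + B k p *m H p.
  rewrite /second_form mulmxDr mulmxBr mulmxDl mulmxBl !mulmxA.
  by rewrite [L p *m D p]LD // mul1mx.
have r0 := inv_sqr_dilation_neq0 conformalF p.
move: (L p *m dm c k D p *m H p) (L p *m A k p *m D p *m H p) (B k p *m H p).
move: (theta p 0 k) (rho p) r0 => t r r0 X Y Z.
rewrite !trmxD !trmxN => E; apply: (scalerI r0).
apply/matrixP => a b; move/matrixP/(_ a b): E.
rewrite !(addmxE, oppmxE, scalemxE) => E.
have := congr1 (fun x => x + 2 * t * r * H p a b) E.
rewrite /= => E'; nra.
Qed.

End SecondFundamentalForm.

(** * Its mixed and vertical components *)

Section ComponentsOfSecondForm.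
Variables (R : realType) (m n : nat) (M : manifold R m) (N : manifold R n).
Variables (g : metric M) (h : metric N) (F : M -> N) (lambda : M -> R).
Hypothesis conformalF : conformal_submersion g h F lambda.
Variables (c : Defs.index M) (d : Defs.index N).

Local Notation O := (chart_region F c d).
Local Notation D := (differential F c d).
Local Notation G := (g c).
Local Notation H := (fun q => h d (F q)).
Local Notation rho := (inv_sqr_dilation lambda).
Local Notation L := (lift_matrix g h F lambda c d).
Local Notation A := (connection g c).
Local Notation B := (base_connection h F c d).
Local Notation S := (second_form g h F c d).
Local Notation theta := (log_dilation_form lambda c).

Let oO := open_chart_region conformalF c d.
Let Oc : O `<=` dom c := @chart_region_dom _ _ _ _ _ F c d.
Let od : open (dom d) := @open_dom _ _ N d.
Let Fd q (Oq : O q) : dom d (F q) := chart_region_img Oq.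
Let CF := sm_map conformalF c d.
Let CD := smx_D conformalF c d.
Let CG : smx c O G := smx_metric g Oc.
Let CL := smx_lift conformalF c d.
Let LG q (Oq : O q) := lift_metric g h lambda Oq.
Let LD q (Oq : O q) := lift_differential conformalF Oq.

Definition second_form_along (q : M) (u : 'rV[R]_m) : 'M[R]_(m, n) :=
  \sum_k u 0 k *: S k q.

Local Notation X := second_form_along.

Lemma second_form_alongD q u v : X q (u + v) = X q u + X q v.
Proof.
rewrite /second_form_along -big_split; apply: eq_bigr => k _.
by rewrite addmxE scalerDl.
Qed.

Lemma second_form_along_delta q i : X q (delta_mx 0 i) = S i q.
Proof.
rewrite /second_form_along (bigD1 i) //= big1 ?addr0.
  by rewrite mxE !eqxx scale1r.
by move=> k ki; rewrite mxE (negbTE ki) scale0r.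
Qed.

Lemma second_form_along_mul q (v u : 'rV[R]_m) :
  v *m X q u = \sum_k u 0 k *: (v *m S k q).
Proof.
by rewrite /second_form_along mulmx_sumr; apply: eq_bigr => k _; rewrite scalemxAr.
Qed.

Lemma second_form_along_sym q u v : O q -> v *m X q u = u *m X q v.
Proof.
move=> Oq; apply/rowP => a; rewrite !second_form_along_mul !summxE.
have E (s t : 'rV[R]_m) : \sum_k (s 0 k *: (t *m S k q)) 0 a
   = \sum_k \sum_j s 0 k * t 0 j * S k q j a.
  apply: eq_bigr => k _; rewrite scalemxE mxE mulr_sumr.
  by apply: eq_bigr => j _; rewrite mulrA.
rewrite (E u v) (E v u) exchange_big /=; apply: eq_bigr => j _.
apply: eq_bigr => k _; rewrite (second_form_sym conformalF k j a Oq).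
by rewrite [u 0 k * _]mulrC.
Qed.

(* A vector [u] with constant coordinates, made vertical at every point: this
   extends a vertical vector to a smooth vertical field. *)
Let vertical_part (u : 'rV[R]_m) (q : M) : 'rV[R]_m := u *m (1%:M - D q *m L q).

Let vertical_partD u q : O q -> vertical_part u q *m D q = 0.
Proof.
by move=> Oq; rewrite -mulmxA mulmxBl mul1mx -mulmxA LD // mulmx1 subrr mulmx0.
Qed.

Let smx_vertical_part u : smx c O (vertical_part u).
Proof.
apply: (smxM oO Oc); first exact: smx_cst.
apply: (smxB oO Oc); first exact: smx_cst.
exact: (smxM oO Oc CD CL).
Qed.

Let vertical_part_id u q : u *m D q = 0 -> vertical_part u q = u.
Proof. by move=> uD; rewrite /vertical_part mulmxBr mulmx1 mulmxA uD mul0mx subr0. Qed.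

Section Integrable.
Hypothesis integrableH : integrable_distribution n (horizontal g F).

(** Extend [u] to a vertical field [w]. On horizontal vectors the form in
    question is, up to sign and scaling, [g (nabla_X w) Y], whose skew part is
    half the exterior derivative of the dual form of [w]; that form annihilates the
    horizontal distribution. *)
Lemma second_form_integrable p u : O p -> u *m D p = 0 ->
  (L p *m X p u *m H p)^T = L p *m X p u *m H p.
Proof.
move=> Op uD.
pose w := vertical_part u.
have Cw : smx c O w by exact: smx_vertical_part.
have wD q : O q -> w q *m D q = 0 by exact: vertical_partD.
have wp : w p = u by exact: vertical_part_id.
pose omega q := w q *m G q.
have Comega : smx c O omega by exact: (smxM oO Oc Cw CG).
have omega0 q v : O q -> horizontal g F c q v -> omega q *m v^T = 0.
  move=> Oq hv; have /innerE E := hv _ ((vertical_chart conformalF _ Oq).2 (wD q Oq)).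
  have := congr1 trmx E; rewrite trmx_mul trmxK trmx_mul mulmxA trmx0.
  by rewrite (gcomp_sym g (Oc Oq)).
pose Om : 'M[R]_m := \matrix_(k, j) pd c k (fun q => omega q 0 j) p.
have LhR t : horizontal g F c p (t *m L p).
  apply/(horizontal_chart conformalF _ Op).
  by rewrite -(mulmxA t) LD // mulmx1.
have LOmL : (L p *m Om *m (L p)^T)^T = L p *m Om *m (L p)^T.
  apply: eq_bilinear_mx => t t'.
  have E := annihilator_closed oO Oc integrableH Comega omega0 Op (LhR t) (LhR t').
  have E' (a b : 'rV[R]_n) : (a *m L p) *m Om *m (b *m L p)^T
      = a *m (L p *m Om *m (L p)^T) *m b^T by rewrite trmx_mul !mulmxA.
  move: E; rewrite -/Om (E' t t') (E' t' t).
  move: (L p *m Om *m (L p)^T) => K ->.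
  transitivity ((t' *m K *m t^T)^T 0 0); last by rewrite [LHS]mxE.
  by rewrite trmx_mul trmxK trmx_mul mulmxA.
(* the derivative of [omega] splits into the covariant derivative [C] of [w]
   and a part [T] which is symmetric because the connection is torsion free *)
pose C : 'M[R]_m := \matrix_(k, j) (dm c k w p + w p *m A k p) 0 j.
pose T : 'M[R]_m := \matrix_(k, j) (w p *m G p *m (A k p)^T) 0 j.
have OmE : Om = C *m G p + T.
  apply/matrixP => k j; rewrite addmxE [LHS]mxE -dmE.
  rewrite (dmM oO Oc k Op Cw CG) (metric_parallel g oO Oc k Op).
  have -> : (C *m G p) k j = ((dm c k w p + w p *m A k p) *m G p) 0 j.
    rewrite [LHS]mxE [RHS]mxE; apply: eq_bigr => l _.
    by congr (_ * _); rewrite [LHS]mxE.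
  rewrite [T k j]mxE -addmxE; congr (fun_of_matrix _ 0 j).
  rewrite mulmxDl mulmxDr trmx_mul (gcomp_sym g (Oc Op)) !mulmxA addrA.
  by [].
have symT : T^T = T.
  apply/matrixP => k j; rewrite [LHS]mxE [LHS]mxE [RHS]mxE [LHS]mxE [RHS]mxE.
  apply: eq_bigr => l _; congr (_ * _); rewrite [LHS]mxE [RHS]mxE.
  exact: (connection_sym g oO Oc _ _ _ Op).
have CD' : C *m D p = - X p u.
  apply/row_matrixP => k; rewrite row_mul.
  have -> : row k C = dm c k w p + w p *m A k p.
    by apply/rowP => j; rewrite [LHS]mxE [LHS]mxE.
  have dwD : dm c k w p *m D p = - (w p *m dm c k D p).
    apply/eqP; rewrite -addr_eq0 -(dmM oO Oc k Op Cw CD); apply/eqP.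
    by rewrite (dm_eq oO Oc k Op wD) dm_cst.
  have -> : row k (- X p u) = - (u *m S k p).
    rewrite linearN /=; congr (- _).
    by rewrite rowE second_form_along_sym // second_form_along_delta.
  rewrite mulmxDl dwD -mulmxA wp /second_form mulmxDr mulmxBr [u *m (D p *m _)]mulmxA.
  by rewrite uD mul0mx addr0 opprB addrC.
have LCGL : L p *m (C *m G p) *m (L p)^T = - rho p *: (L p *m X p u *m H p).
  have GL : G p *m (L p)^T = rho p *: (D p *m H p).
    rewrite -{1}(gcomp_sym g (Oc Op)) -trmx_mul LG // linearZ /= trmx_mul trmxK.
    by rewrite (base_metric_sym h Op).
  rewrite -!mulmxA GL -!scalemxAr [C *m _]mulmxA CD' mulNmx mulmxN scalerN scaleNr.
  by rewrite !mulmxA.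
move: LOmL; rewrite OmE mulmxDr mulmxDl LCGL trmxD.
have -> : (L p *m T *m (L p)^T)^T = L p *m T *m (L p)^T.
  by rewrite !trmx_mul trmxK symT mulmxA.
move=> /addIr; rewrite linearZ /= => /scalerI; apply.
by rewrite oppr_eq0 (inv_sqr_dilation_neq0 conformalF).
Qed.

End Integrable.

Lemma vertical_change q v c' : dom c q -> dom c' q ->
  vertical F c q v -> vertical F c' q (v *m transition c c' q).
Proof.
move=> cq c'q vv d' d'Fq; rewrite -mulmxA.
pose U := chart_region F c d' `&` dom c'.
have oU' := open_chart_region conformalF c d'.
have oU : open U by apply: openI => //; exact: open_dom.
have Uc : U `<=` dom c by move=> s [[]].
have Uc' : U `<=` dom c' by move=> s [].
have CU a : smooth_within c U (fun q : M => coord c' (idfun q) 0 a).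
  exact: sm_coord_change.
have CF' a : smooth_within c' U (fun q => coord d' (F q) 0 a).
  apply: (sm_change oU Uc Uc').
  by apply: (sm_sub (O := chart_region F c d')) (sm_map conformalF c d' a) => s [].
have Uq : U q by [].
have <- : differential F c d' q = transition c c' q *m differential F c' d' q.
  exact: (differential_comp (F := idfun) oU Uc oU Uc' (fun q => id) CU CF').
exact: vv.
Qed.

Section Geodesic.
Hypothesis geodesicF : totally_geodesic_fibers g F.

Lemma vertical_field p u : O p -> u *m D p = 0 ->
  exists (U : vector_field M) (k : R),
    [/\ section_of (vertical F) U, k != 0 & U c p = k *: u].
Proof.
move=> Op uD.
have [U [kappa [_ kp0 UO U0]]] :=
  localized_field oO Oc Op (smx_vertical_part u).
exists U, (kappa p); split=> //.
  move=> c' q c'q; have [Oq|nOq] := pselect (O q); last first.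
    by move=> d' _; rewrite (U0 c' q c'q nOq) mul0mx.
  have vq : vertical F c' q (vertical_part u q *m transition c c' q).
    apply: (vertical_change (Oc Oq) c'q).
    by apply/(vertical_chart conformalF _ Oq); exact: vertical_partD.
  by move=> d' /vq E; rewrite (UO c' q c'q Oq) -scalemxAl E scaler0.
rewrite (UO c p (Oc Op) Op) (transition_id (Oc Op)) mulmx1.
by rewrite (vertical_part_id uD).
Qed.

(** For vertical fields the second fundamental form of [F] is, up to sign, the
    image under [F] of [nabla_U V], and this is vertical. *)
Lemma second_form_vertical p (u v : 'rV[R]_m) : O p ->
  u *m D p = 0 -> v *m D p = 0 -> v *m X p u = 0.
Proof.
move=> Op uD vD.
have [U [k [Uv k0 Up]]] := vertical_field Op uD.
have [V [l [Vv l0 Vp]]] := vertical_field Op vD.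
have := (vertical_chart conformalF _ Op).1 (geodesicF Uv Vv (Oc Op)).
have CV : smx c O (V c).
  by move=> a b; rewrite (ord1 a); apply: (sm_sub Oc); exact: vcomp_smooth.
have VD q : O q -> V c q *m D q = 0.
  by move=> Oq; apply/(vertical_chart conformalF _ Oq)/Vv; exact: Oc.
have -> : nabla g U V c p = \sum_i U c p 0 i *: (dm c i (V c) p + V c p *m A i p).
  apply/rowP => a; rewrite [LHS]mxE summxE -big_split; apply: eq_bigr => i _ /=.
  rewrite scalemxE addmxE dmE mulrDr [(_ *m _) _ _]mxE; congr (_ + _).
  rewrite mulr_sumr; apply: eq_bigr => j _; rewrite [A _ _ _ _]mxE; ring.
rewrite mulmx_suml => E.
have E' : \sum_i U c p 0 i *: (V c p *m S i p) = 0.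
  rewrite -[RHS]oppr0 -[in RHS]E -sumrN; apply: eq_bigr => i _.
  have dVD : dm c i (V c) p *m D p = - (V c p *m dm c i D p).
    apply/eqP; rewrite -addr_eq0 -(dmM oO Oc i Op CV CD); apply/eqP.
    by rewrite (dm_eq oO Oc i Op VD) dm_cst.
  rewrite -scalemxAl mulmxDl dVD -scalerN; congr (_ *: _).
  rewrite /second_form mulmxDr mulmxBr [V c p *m (D p *m _)]mulmxA VD // mul0mx.
  by rewrite addr0 opprD opprK mulmxA.
move: E'; rewrite -second_form_along_mul Vp -scalemxAl Up.
have -> : X p (k *: u) = k *: X p u.
  rewrite /second_form_along scaler_sumr; apply: eq_bigr => i _.
  by rewrite scalemxE scalerA.
move=> /eqP; rewrite -scalemxAr !scaler_eq0 (negbTE k0) (negbTE l0) /=.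
by move/eqP.
Qed.

End Geodesic.

End ComponentsOfSecondForm.

(** * Projective equivalence and curvature *)

Section StructureEquations.
Variables (R : realType) (m n : nat) (M : manifold R m) (N : manifold R n).
Variables (g : metric M) (h : metric N) (F : M -> N) (lambda : M -> R).
Hypothesis conformalF : conformal_submersion g h F lambda.
Hypothesis homotheticF : horizontally_homothetic g F lambda.
Hypothesis geodesicF : totally_geodesic_fibers g F.
Hypothesis integrableH : integrable_distribution n (horizontal g F).
Variables (c : Defs.index M) (d : Defs.index N).

Local Notation O := (chart_region F c d).
Local Notation D := (differential F c d).
Local Notation G := (g c).
Local Notation H := (fun q => h d (F q)).
Local Notation rho := (inv_sqr_dilation lambda).
Local Notation L := (lift_matrix g h F lambda c d).
Local Notation A := (connection g c).
Local Notation B := (base_connection h F c d).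
Local Notation S := (second_form g h F c d).
Local Notation X := (second_form_along g h F c d).
Local Notation theta := (log_dilation_form lambda c).
Local Notation e i := (delta_mx 0 i : 'rV[R]_m).

Let oO := open_chart_region conformalF c d.
Let Oc : O `<=` dom c := @chart_region_dom _ _ _ _ _ F c d.
Let od : open (dom d) := @open_dom _ _ N d.
Let Fd q (Oq : O q) : dom d (F q) := chart_region_img Oq.
Let CF := sm_map conformalF c d.
Let CD := smx_D conformalF c d.
Let CG : smx c O G := smx_metric g Oc.
Let CL := smx_lift conformalF c d.
Let Ctheta : smx c O theta := smx_log_dilation conformalF c d.
Let CB i : smx c O (B i) := smx_base_connection conformalF c d i.
Let CA i : smx c O (A i) := smx_connection g oO Oc i.
Let LG q (Oq : O q) := lift_metric g h lambda Oq.
Let LD q (Oq : O q) := lift_differential conformalF Oq.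

Lemma log_dilation_vertical q : O q -> theta q *m invmx (G q) *m D q = 0.
Proof.
move=> Oq; have [_ +] := homotheticF (Oc Oq).
move=> /(vertical_chart conformalF _ Oq); rewrite subr0 /grad => E.
by rewrite /log_dilation_form -!scalemxAl E scaler0.
Qed.

Lemma lift_log_dilation q : O q -> L q *m (theta q)^T = 0.
Proof.
move=> Oq; apply: trmx_inj; rewrite trmx_mul trmxK trmx0 /lift_matrix.
rewrite linearZ /= !trmx_mul trmxK (invmx_metric_sym g Oq).
rewrite (base_metric_sym h Oq).
by rewrite -scalemxAr !mulmxA (log_dilation_vertical Oq) mul0mx scaler0.
Qed.

Lemma second_form_conformal_along p u : O p ->
  L p *m X p u *m H p + (L p *m X p u *m H p)^T
  = (2 * (u *m (theta p)^T) 0 0) *: H p.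
Proof.
move=> Op.
have -> : L p *m X p u *m H p = \sum_k u 0 k *: (L p *m S k p *m H p).
  rewrite /second_form_along mulmx_sumr mulmx_suml; apply: eq_bigr => k _.
  by rewrite -scalemxAr -scalemxAl.
rewrite linear_sum -big_split mxE mulr_sumr scaler_suml.
apply: eq_bigr => k _; rewrite /= linearZ -scalerDr.
rewrite (second_form_conformal conformalF k Op) scalerA [_^T _ _]mxE.
by congr (_ *: _); rewrite mulrCA.
Qed.

Lemma base_metric_unit p : O p -> H p \in unitmx.
Proof. by move=> Op; exact: metric_unit (Fd Op). Qed.

(** Integrability removes the skew part, and conformality determines the
    symmetric part. *)
Lemma second_form_mixed p u : O p -> u *m D p = 0 ->
  L p *m X p u = ((u *m (theta p)^T) 0 0)%:M.
Proof.
move=> Op uD; have uH := base_metric_unit Op.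
have := second_form_conformal_along u Op.
rewrite (second_form_integrable conformalF integrableH Op uD).
rewrite -mulr2n -scaler_nat -scalerA => /scalerI E.
apply: (can_inj (mulmxK uH)); rewrite mul_scalar_mx.
by apply: E; rewrite pnatr_eq0.
Qed.

(** The trilinear form [b, a, r |-> b *m Y a *m r^T] is symmetric in its first two
    arguments, as the second fundamental form is, and skew in the last two, as
    [theta] vanishes on horizontal vectors; such a form is zero. *)
Lemma second_form_horizontal p t : O p -> L p *m X p (t *m L p) = 0.
Proof.
move=> Op; have uH := base_metric_unit Op.
pose Y t := L p *m X p (t *m L p) *m H p.
have skewY t' : (Y t')^T = - Y t'.
  have := second_form_conformal_along (t' *m L p) Op.
  rewrite -/(Y t') -mulmxA lift_log_dilation // mulmx0 mxE mulr0 scale0r.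
  by move/eqP; rewrite addrC addr_eq0 => /eqP.
pose y (a b r : 'rV[R]_n) := (b *m Y a *m r^T) 0 0.
have ysym a b r : y a b r = y b a r.
  rewrite /y /Y !mulmxA.
  by rewrite (second_form_along_sym conformalF (a *m L p) (b *m L p) Op).
have yskew a b r : y a b r = - y a r b.
  rewrite /y; transitivity ((b *m Y a *m r^T)^T 0 0); first by rewrite [RHS]mxE.
  by rewrite trmx_mul trmxK trmx_mul skewY mulNmx mulmxN mxE mulmxA.
have y0 a b r : y a b r = 0.
  have E : y a b r = - y a b r.
    by rewrite {1}yskew ysym yskew opprK ysym yskew ysym.
  by lra.
suff Y0 : Y t = 0 by rewrite -[LHS](mulmxK uH) -/(Y t) Y0 mul0mx.
apply: eq_bilinear_mx => b r; rewrite -/(y t b r) y0.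
by rewrite mulmx0 mul0mx mxE.
Qed.

(** The second fundamental form of [F] is the symmetric product of [theta] and
    [dF]. Split both vectors into their horizontal and vertical parts: each of
    the four terms is known, and [theta] only sees vertical parts. *)
Lemma second_form_alongE p u v : O p ->
  v *m X p u = (u *m (theta p)^T) 0 0 *: (v *m D p)
             + (v *m (theta p)^T) 0 0 *: (u *m D p).
Proof.
move=> Op.
have split_row (w : 'rV[R]_m) : exists w', [/\ w = w *m D p *m L p + w',
    w' *m D p = 0 & w *m (theta p)^T = w' *m (theta p)^T].
  exists (w - w *m D p *m L p); split; first by rewrite addrC subrK.
    by rewrite mulmxBl -[X in _ - X]mulmxA LD // mulmx1 subrr.
  by rewrite mulmxBl -[X in _ - X]mulmxA lift_log_dilation // mulmx0 subr0.
have [u' [Eu uD ut]] := split_row u; have [v' [Ev vD vt]] := split_row v.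
rewrite ut vt {1}Ev {1}Eu second_form_alongD mulmxDl !mulmxDr.
rewrite (second_form_vertical conformalF geodesicF Op uD vD) addr0.
rewrite -!(mulmxA (v *m D p)) second_form_horizontal // mulmx0 add0r.
rewrite (second_form_mixed Op uD) mul_mx_scalar; congr (_ + _).
rewrite (second_form_along_sym conformalF _ _ Op) -mulmxA.
by rewrite (second_form_mixed Op vD) mul_mx_scalar.
Qed.

(** The connection projectively equivalent to that of [g] for which [F] is an
    affine map to the base: this is the meaning of [second_form_alongE], and
    the form in which that formula can be differentiated without
    developing the products ([dm_differential]). *)
Definition projective_connection (i : 'I_m) (q : M) : 'M[R]_m :=
  A i q + (theta q 0 i *: 1%:M + (theta q)^T *m e i).

Local Notation P := projective_connection.

Lemma smx_projective_connection i : smx c O (P i).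
Proof.
apply: (smxD oO Oc (CA i)); apply: (smxD oO Oc).
  by apply: (smxZ oO Oc); [exact: Ctheta|exact: smx_cst].
by apply: (smxM oO Oc); [exact: smxT|exact: smx_cst].
Qed.

Lemma dm_differential i p : O p ->
  dm c i D p = P i p *m D p - D p *m B i p.
Proof.
move=> Op.
have SE : S i p = theta p 0 i *: D p + (theta p)^T *m (e i *m D p).
  apply/row_matrixP => j; rewrite !rowE -second_form_along_delta.
  rewrite second_form_alongE // mulmxDr -scalemxAr [e j *m (_ *m _)]mulmxA.
  have th k : (e k *m (theta p)^T) 0 0 = theta p 0 k.
    by rewrite -rowE [LHS]mxE [LHS]mxE.
  rewrite !th; congr (_ + _).
  have -> : e j *m (theta p)^T = (theta p 0 j)%:M.
    by rewrite [LHS]mx11_scalar th.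
  by rewrite mul_scalar_mx.
move: SE; rewrite /second_form => /eqP; rewrite -subr_eq0 => /eqP SE.
rewrite /projective_connection mulmxDl mulmxDl -scalemxAl mul1mx -mulmxA.
move: SE; move: (dm c i D p) (A i p *m D p) (D p *m B i p) => Z1 Z2 Z3.
move: (theta p 0 i *: D p) ((theta p)^T *m (e i *m D p)) => Z4 Z5 /eqP.
rewrite subr_eq0 => /eqP E; rewrite -E.
by mx_linear.
Qed.

(** The curvature of the pulled back connection. *)
Definition base_curvature (k i : 'I_m) (q : M) : 'M[R]_n :=
  dm c k (B i) q - dm c i (B k) q + (B i q *m B k q - B k q *m B i q).

(** The derivatives of [D] drop out, being symmetric in [k] and [i]. *)
Lemma base_curvatureE k i p : O p -> base_curvature k i p =
  \sum_a \sum_b (D p k a * D p i b) *: curvature h d a b (F p).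
Proof.
move=> Op.
have CA' b : smx d (dom d) (connection h d b).
  exact: (smx_connection h od (fun q => id)).
have CAF b : smx c O (connection h d b \o F).
  exact: (smx_comp oO Oc od (fun q => id) Fd CF (CA' b)).
have dB k' i' : dm c k' (B i') p =
   \sum_b (dm c k' D p i' b *: connection h d b (F p))
   + \sum_a \sum_b (D p k' a * D p i' b) *: dm d a (connection h d b) (F p).
  have CDA b : smx c O (fun q => D q i' b *: (connection h d b \o F) q).
    by apply: (smxZ oO Oc); [exact: CD|exact: CAF].
  have -> : dm c k' (B i') p =
      \sum_b dm c k' (fun q => D q i' b *: (connection h d b \o F) q) p.
    exact: (dm_sum oO Oc k' _ _ Op CDA).
  rewrite exchange_big -big_split; apply: eq_bigr => b _ /=.
  rewrite (dmZ oO Oc k' Op (CD i' b) (CAF b)) dmE; congr (_ + _).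
  rewrite (dm_comp oO Oc od (fun q => id) Fd CF k' Op (CA' b)) scaler_sumr.
  by apply: eq_bigr => a _; rewrite scalerA mulrC.
have BB k' i' : B i' p *m B k' p = \sum_a \sum_b (D p k' a * D p i' b) *:
    (connection h d b (F p) *m connection h d a (F p)).
  rewrite exchange_big /= /base_connection mulmx_suml; apply: eq_bigr => b _.
  rewrite mulmx_sumr; apply: eq_bigr => a _.
  by rewrite -scalemxAl -scalemxAr scalerA mulrC.
have E1 : \sum_b (dm c k D p i b *: connection h d b (F p))
        = \sum_b (dm c i D p k b *: connection h d b (F p)).
  apply: eq_bigr => b _; apply: (congr1 (fun z => z *: connection h d b (F p))).
  exact: (dm_differential_sym oO Oc CF k i b Op).
have swap (f : 'I_n -> 'I_n -> 'M[R]_n) :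
    \sum_a \sum_b (D p i a * D p k b) *: f a b
    = \sum_a \sum_b (D p k a * D p i b) *: f b a.
  rewrite exchange_big; apply: eq_bigr => a _; apply: eq_bigr => b _.
  by rewrite mulrC.
rewrite /base_curvature (dB k i) (dB i k) (BB k i) (BB i k) E1 !swap.
have cancel (Y Y1 Y2 : 'M[R]_n) : Y + Y1 - (Y + Y2) = Y1 - Y2 by mx_linear.
rewrite cancel -!sumrB -big_split; apply: eq_bigr => a _ /=.
rewrite -!sumrB -big_split; apply: eq_bigr => b _ /=.
by rewrite -!scalerBr -scalerDr.
Qed.

(** The correction term in the comparison of the curvatures of two projectively
    equivalent connections: [nabla theta - theta * theta], as a column. *)
Definition dilation_defect (k : 'I_m) (q : M) : 'cV[R]_m :=
  (dm c k theta q)^T - A k q *m (theta q)^T - theta q 0 k *: (theta q)^T.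

Local Notation t := dilation_defect.

Lemma projective_curvature k i p : O p ->
  dm c k (P i) p - dm c i (P k) p + (P i p *m P k p - P k p *m P i p)
  = curvature g c k i p + (t k p *m e i - t i p *m e k).
Proof.
move=> Op.
have Cth j : smooth_within c O (fun q => theta q 0 j) by exact: Ctheta.
have C1 : smx c O (fun=> 1%:M : 'M[R]_m) by exact: smx_cst.
have Ce j : smx c O (fun=> e j) by exact: smx_cst.
have CthT : smx c O (fun q => (theta q)^T) by exact: smxT.
have dP k' i' : dm c k' (P i') p = dm c k' (A i') p
   + (dm c k' theta p 0 i' *: 1%:M + (dm c k' theta p)^T *m e i').
  have Cs : smx c O (fun q => theta q 0 i' *: 1%:M : 'M[R]_m).
    exact: (smxZ oO Oc (Cth i') C1).
  have Ct : smx c O (fun q => (theta q)^T *m e i').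
    exact: (smxM oO Oc CthT (Ce i')).
  rewrite (dmD oO Oc k' Op (CA i') (smxD oO Oc Cs Ct)); congr (_ + _).
  rewrite (dmD oO Oc k' Op Cs Ct); congr (_ + _).
    by rewrite (dmZ oO Oc k' Op (Cth i') C1) dm_cst scaler0 addr0 -dmE.
  by rewrite (dmM oO Oc k' Op CthT (Ce i')) dm_cst mulmx0 addr0 dmT.
have eA : e k *m A i p = e i *m A k p.
  apply/rowP => j; rewrite -!rowE [LHS]mxE [RHS]mxE.
  exact: (connection_sym g oO Oc i k j Op).
have eth j : e j *m (theta p)^T = (theta p 0 j)%:M.
  rewrite [LHS]mx11_scalar; congr (_%:M).
  by rewrite -rowE [LHS]mxE [LHS]mxE.
rewrite [X in X - _ + _](dP k i) [X in _ - X + _](dP i k) {dP}.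
rewrite /curvature /projective_connection /dilation_defect.
move: (log_dilation_closed conformalF k i Op).
move: (dm c k (A i) p) (dm c i (A k) p) => dA dA'.
move: (dm c k theta p) (dm c i theta p) => th th' ->.
move: (th' 0 k) => s.
move: eA (eth i) (eth k); move: (theta p 0 i) (theta p 0 k) => ti tk.
move: (A i p) (A k p) (theta p) => Ai Ak v eA ei ek.
rewrite !(mulmxDl, mulmxDr, mulmxBl, mulmxBr, mulNmx, mulmxN).
rewrite -!(scalemxAl, scalemxAr) !(mulmx1, mul1mx) !scalerA.
rewrite -!mulmxA ![e i *m (_ *m _)]mulmxA ![e k *m (_ *m _)]mulmxA.
rewrite eA ei ek !mul_scalar_mx -!scalemxAr.
by mx_linear.
Qed.

(** The second derivatives of [D], computed from [dm_differential], commute: the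
    projective connection and the pulled back connection have [D]-related
    curvatures. *)
Lemma curvature_differential k i p : O p ->
  curvature g c k i p *m D p = D p *m base_curvature k i p
    - t k p *m (e i *m D p) + t i p *m (e k *m D p).
Proof.
move=> Op; have CP := smx_projective_connection.
have dd k' i' : dm c k' (dm c i' D) p =
    dm c k' (P i') p *m D p + P i' p *m (P k' p *m D p - D p *m B k' p)
    - ((P k' p *m D p - D p *m B k' p) *m B i' p + D p *m dm c k' (B i') p).
  rewrite (dm_eq oO Oc k' Op (dm_differential i')).
  have CPD : smx c O (fun q => P i' q *m D q) by exact: smxM.
  have CDB : smx c O (fun q => D q *m B i' q) by exact: smxM.
  rewrite (dmB oO Oc k' Op CPD CDB) (dmM oO Oc k' Op (CP i') CD).
  by rewrite (dmM oO Oc k' Op CD (CB i')) (dm_differential k' Op).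
have E := etrans (esym (dd k i)) (etrans (dm_comm oO Oc k i Op CD) (dd i k)).
have KE : curvature g c k i p =
   dm c k (P i) p - dm c i (P k) p + (P i p *m P k p - P k p *m P i p)
   - (t k p *m e i - t i p *m e k).
  by rewrite (projective_curvature k i Op) addrK.
rewrite KE /base_curvature.
move: E; move: (dm c k (P i) p) (dm c i (P k) p) => dPi dPk.
move: (dm c k (B i) p) (dm c i (B k) p) => dBi dBk.
move: (P i p) (P k p) (B i p) (B k p) (t i p) (t k p) (D p) (e i) (e k).
move=> Pi Pk Bi Bk ti tk Dp ei ek.
rewrite !(mulmxDl, mulmxDr, mulmxBl, mulmxBr, mulNmx, mulmxN) !mulmxA => E.
apply/matrixP => a b; have := congr1 (fun Y : 'M[R]_(m, n) => Y a b) E.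
rewrite /= !(addmxE, oppmxE) => E'.
lra.
Qed.

End StructureEquations.

(** * The Ricci tensor on horizontal vectors *)

Lemma exchange_sum4 (V : nmodType) (I J A B : finType)
  (f : I -> J -> A -> B -> V) :
  \sum_i \sum_j \sum_a \sum_b f i j a b
  = \sum_a \sum_b \sum_i \sum_j f i j a b.
Proof.
transitivity (\sum_i \sum_a \sum_j \sum_b f i j a b).
  by apply: eq_bigr => i _; exact: exchange_big.
rewrite exchange_big; apply: eq_bigr => a _ /=.
transitivity (\sum_i \sum_b \sum_j f i j a b).
  by apply: eq_bigr => i _; exact: exchange_big.
exact: exchange_big.
Qed.

Section RicciHorizontal.
Variables (R : realType) (m n : nat) (M : manifold R m) (N : manifold R n).
Variables (g : metric M) (h : metric N) (F : M -> N) (lambda : M -> R).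
Hypothesis conformalF : conformal_submersion g h F lambda.
Hypothesis homotheticF : horizontally_homothetic g F lambda.
Hypothesis geodesicF : totally_geodesic_fibers g F.
Hypothesis integrableH : integrable_distribution n (horizontal g F).
Variables (c : Defs.index M) (d : Defs.index N).

Local Notation O := (chart_region F c d).
Local Notation D := (differential F c d).
Local Notation G := (g c).
Local Notation H := (fun q => h d (F q)).
Local Notation rho := (inv_sqr_dilation lambda).
Local Notation L := (lift_matrix g h F lambda c d).
Local Notation A := (connection g c).
Local Notation B := (base_connection h F c d).
Local Notation theta := (log_dilation_form lambda c).
Local Notation t := (dilation_defect g lambda c).
Local Notation K := (curvature g c).
Local Notation e i := (delta_mx 0 i : 'rV[R]_m).

Let oO := open_chart_region conformalF c d.
Let Oc : O `<=` dom c := @chart_region_dom _ _ _ _ _ F c d.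
Let od : open (dom d) := @open_dom _ _ N d.
Let Fd q (Oq : O q) : dom d (F q) := chart_region_img Oq.
Let CD := smx_D conformalF c d.
Let CG : smx c O G := smx_metric g Oc.
Let CGV := smx_Ginv conformalF c d.
Let Ctheta : smx c O theta := smx_log_dilation conformalF c d.
Let CA i : smx c O (A i) := smx_connection g oO Oc i.
Let LD q (Oq : O q) := lift_differential conformalF Oq.

Lemma horizontal_lower p w : O p -> horizontal g F c p w ->
  G p *m w^T = D p *m (rho p *: (H p *m (w *m D p)^T)).
Proof.
move=> Op /(horizontal_chart conformalF _ Op) hw.
have E : w *m G p = rho p *: (w *m D p *m H p *m (D p)^T).
  by rewrite {1}hw -mulmxA (lift_metric g h lambda Op) -scalemxAr !mulmxA.
have := congr1 trmx E; rewrite trmx_mul (gcomp_sym g (Oc Op)) => ->.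
rewrite linearZ /= -scalemxAr; congr (_ *: _).
by rewrite !trmx_mul trmxK (base_metric_sym h Op) !mulmxA.
Qed.

Definition log_dilation_norm (q : M) : R :=
  (theta q *m invmx (G q) *m (theta q)^T) 0 0.

(** The gradient [eta] of the logarithm of the dilation is vertical; differentiate
    [eta *m D = 0] and use [dm_differential]. *)
Lemma dilation_defect_horizontal j p w : O p -> horizontal g F c p w ->
  (w *m t j p) 0 0 = - (log_dilation_norm p * (e j *m G p *m w^T) 0 0).
Proof.
move=> Op hw; have uG q (Oq : O q) := metric_unit g (Oc Oq).
have sG := gcomp_sym g (Oc Op).
pose eta q := theta q *m invmx (G q).
have Ceta : smx c O eta by exact: (smxM oO Oc Ctheta CGV).
have etaD q : O q -> eta q *m D q = 0 by exact: (log_dilation_vertical conformalF homotheticF).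
have thE q : O q -> theta q = eta q *m G q.
  by move=> Oq; rewrite /eta mulmxKV //; exact: uG.
pose nu := dm c j eta p + eta p *m A j p.
have nuD : nu *m D p = - (log_dilation_norm p *: (e j *m D p)).
  have E : dm c j eta p *m D p = - (eta p *m dm c j D p).
    apply/eqP; rewrite -addr_eq0 -(dmM oO Oc j Op Ceta CD); apply/eqP.
    by rewrite (dm_eq oO Oc j Op etaD) dm_cst.
  rewrite /nu mulmxDl E.
  rewrite (dm_differential conformalF homotheticF geodesicF integrableH j Op).
  rewrite mulmxBr [eta p *m (D p *m _)]mulmxA etaD // mul0mx subr0.
  rewrite /projective_connection mulmxDl mulmxDr opprD mulmxA addrAC addNr add0r.
  rewrite mulmxDl mulmxDr -scalemxAl mul1mx -scalemxAr etaD // scaler0 add0r.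
  rewrite !mulmxA [eta p *m (theta p)^T]mx11_scalar -/(log_dilation_norm p).
  by rewrite mul_scalar_mx -scalemxAl.
have tE : t j p = G p *m nu^T - theta p 0 j *: (theta p)^T.
  rewrite /dilation_defect (dm_eq oO Oc j Op thE) (dmM oO Oc j Op Ceta CG).
  rewrite (metric_parallel g oO Oc j Op); congr (_ - _).
  rewrite (thE p Op) /nu.
  move: (dm c j eta p) (eta p) (A j p) (G p) sG => v u Aj S sS.
  rewrite !(mulmxDr, mulmxDl, trmxD, trmx_mul, trmxK) sS !mulmxA.
  by mx_linear.
have wth : w *m (theta p)^T = 0.
  have := (horizontal_chart conformalF w Op).1 hw => ->.
  by rewrite -mulmxA (lift_log_dilation conformalF homotheticF Op) mulmx0.
rewrite tE mulmxBr -scalemxAr wth scaler0 subr0.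
have -> : w *m (G p *m nu^T) = (nu *m (G p *m w^T))^T.
  by rewrite !trmx_mul trmxK sG mulmxA.
rewrite [LHS]mxE -[e j *m G p *m _]mulmxA (horizontal_lower Op hw).
by rewrite !mulmxA nuD mulNmx -scalemxAl oppmxE scalemxE.
Qed.

Lemma row_sum_mul k (y : 'rV[R]_k) (C : 'cV[R]_k) :
  \sum_j y 0 j * ((delta_mx 0 j : 'rV[R]_k) *m C) 0 0 = (y *m C) 0 0.
Proof.
rewrite [RHS]mxE; apply: eq_bigr => j _; congr (_ * _).
by rewrite -rowE mxE.
Qed.

Lemma mul_mx11 (x y : 'M[R]_1) : (x *m y) 0 0 = x 0 0 * y 0 0.
Proof. by rewrite mxE big_ord1. Qed.

(** The first term comes from the base, whose Einstein constant is [a]; the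
    two others are the trace of [nabla theta - theta * theta] and the squared
    norm of [theta]. *)
Definition ricci_factor (a : R) (q : M) : R :=
  a * (lambda q * lambda q)
  + \sum_i (e i *m invmx (G q) *m t i q) 0 0 + log_dilation_norm q.

Lemma sm_ricci_factor a : smooth_within c O (ricci_factor a).
Proof.
have Cl := sm_lambda conformalF c d.
apply: (smD oO Oc); last first.
  apply: (smxM oO Oc); last exact: smxT.
  exact: (smxM oO Oc Ctheta CGV).
apply: (smD oO Oc).
  by apply: (smM oO Oc); [exact: sm_cst|exact: smM].
apply: (sm_sum oO Oc) => i; apply: (smxM oO Oc).
  by apply: (smxM oO Oc); [exact: smx_cst|exact: CGV].
have CthT : smx c O (fun q => (theta q)^T) by exact: smxT.
apply: (smxB oO Oc); last by apply: (smxZ oO Oc); [exact: Ctheta|].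
apply: (smxB oO Oc); last exact: (smxM oO Oc (CA i) CthT).
by apply: (smxT oO Oc); exact: (smx_dm oO Oc i Ctheta).
Qed.

Section AtPoint.
Variables (p : M) (y w : 'rV[R]_m).
Hypotheses (Op : O p) (hy : horizontal g F c p y) (hw : horizontal g F c p w).

Let z : 'cV[R]_n := rho p *: (H p *m (w *m D p)^T).
Let Gw : G p *m w^T = D p *m z := horizontal_lower Op hw.
Let GV := invmx (G p).
Let uG : G p \in unitmx := metric_unit g (Oc Op).
Let sGV : GV^T = GV := invmx_metric_sym g Op.

(* Lower an index with the metric and use the skew symmetry of the curvature:
   the endomorphism is then followed by [D], and [curvature_differential]
   applies. *)
Let curvature_entry i j : (w *m K i j p) 0 i =
  - (e i *m GV *m (K i j p *m D p) *m z) 0 0.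
Proof.
have -> : e i *m GV *m (K i j p *m D p) *m z = e i *m GV *m (K i j p *m G p) *m w^T.
  by rewrite -!mulmxA Gw.
transitivity ((w *m K i j p *m (e i)^T) 0 0).
  by rewrite trmx_delta -colE [RHS]mxE.
rewrite -[K i j p in LHS](mulmxK uG).
have -> : w *m (K i j p *m G p *m invmx (G p)) *m (e i)^T
     = (e i *m GV *m (K i j p *m G p)^T *m w^T)^T.
  by rewrite !(trmx_mul, trmxK) sGV !mulmxA.
rewrite (curvature_skew g oO Oc i j Op) mulmxN mulNmx [LHS]mxE oppmxE.
by [].
Qed.

(* The same manipulation backwards on the base, where [D^T G^-1 D] is the
   inverse of the metric up to the factor [lambda^2]. *)
Let base_sum : \sum_i \sum_j y 0 j *
    (e i *m GV *m (D p *m base_curvature h F c d i j p) *m z) 0 0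
  = - inner (ricci h d (F p)) (y *m D p) (w *m D p).
Proof.
pose Q := (D p)^T *m GV *m D p.
have uH := base_metric_unit h Op.
have QH : rho p *: (Q *m H p) = 1%:M.
  have : (rho p *: (H p *m Q))^T = 1%:M.
    rewrite -trmx1 -(LD Op) /lift_matrix -scalemxAl /Q !mulmxA.
    by [].
  rewrite linearZ /= trmx_mul (base_metric_sym h Op) /Q !trmx_mul trmxK.
  by rewrite -/GV sGV mulmxA.
have entry a b : ((delta_mx 0 a : 'rV[R]_n) *m (Q *m curvature h d a b (F p) *m z)) 0 0
    = - (w *m D p *m curvature h d a b (F p)) 0 a.
  have sk := curvature_skew h od (fun q => id) a b (Fd Op).
  rewrite trmx_mul (base_metric_sym h Op) in sk.
  have E : Q *m curvature h d a b (F p) *m z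
      = - (w *m D p *m curvature h d a b (F p))^T.
    have cvH : curvature h d a b (F p) *m H p
        = - (H p *m (curvature h d a b (F p))^T) by rewrite sk opprK.
    rewrite /z -scalemxAr.
    have -> : Q *m curvature h d a b (F p) *m (H p *m (w *m D p)^T)
        = - (Q *m H p *m ((curvature h d a b (F p))^T *m (w *m D p)^T)).
      by rewrite !mulmxA -(mulmxA Q) cvH mulmxN !mulNmx !mulmxA.
    by rewrite scalerN scalemxAl QH mul1mx -trmx_mul.
  by rewrite E mulmxN oppmxE -rowE [in LHS]mxE [in LHS]mxE.
rewrite ricciE -sumrN; clearbody Gw z.
under [RHS]eq_bigr do rewrite -sumrN.
transitivity (\sum_i \sum_j \sum_a \sum_b y 0 j * D p j b * (D p i a *
    (e i *m (GV *m D p *m curvature h d a b (F p) *m z)) 0 0)).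
  apply: eq_bigr => i _; apply: eq_bigr => j _.
  rewrite (base_curvatureE conformalF i j Op) !mulmx_sumr mulmx_suml summxE mulr_sumr.
  apply: eq_bigr => a _; rewrite !mulmx_sumr mulmx_suml summxE mulr_sumr.
  apply: eq_bigr => b _; rewrite -!scalemxAr -scalemxAl scalemxE !mulmxA; ring.
rewrite exchange_sum4; apply: eq_bigr => a _; apply: eq_bigr => b _.
under eq_bigr do rewrite -mulr_suml.
rewrite -mulr_sumr.
have -> : \sum_j y 0 j * D p j b = (y *m D p) 0 b by rewrite [RHS]mxE.
rewrite -mulrN; congr (_ * _).
rewrite -entry /Q -!(mulmxA (D p)^T) mulmxA -rowE -tr_col.
rewrite -row_sum_mul; apply: eq_bigr => i _; congr (_ * _).
by rewrite [RHS]mxE [RHS]mxE.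
Qed.

(** After [curvature_entry] and [curvature_differential] the trace is a sum of
    three terms: the Ricci curvature of the base, a multiple of the metric by the
    trace of the defect, and a term evaluated by
    [dilation_defect_horizontal]. *)
Lemma ricci_horizontal a : ricci h d (F p) = a *: h d (F p) ->
  inner (ricci g c p) y w = ricci_factor a p * inner (g c p) y w.
Proof.
move=> ricE; rewrite ricciE.
have split_sum i j : y 0 j * (w *m K i j p) 0 i =
   - (y 0 j * (e i *m GV *m (D p *m base_curvature h F c d i j p) *m z) 0 0)
   + (e i *m GV *m t i p) 0 0 * (y 0 j * (e j *m (G p *m w^T)) 0 0)
   - y 0 j * ((w *m G p) 0 i * (e i *m (GV *m t j p)) 0 0).
  rewrite curvature_entry.
  rewrite (curvature_differential conformalF homotheticF geodesicF integrableH i j Op).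
  rewrite mulmxDr mulmxBr mulmxDl mulmxBl !addmxE oppmxE.
  have E k l : (e i *m GV *m (t k p *m (e l *m D p)) *m z) 0 0
      = (e i *m GV *m t k p) 0 0 * (e l *m (G p *m w^T)) 0 0.
    by rewrite -mul_mx11 Gw !mulmxA.
  rewrite !E [(e i *m (G p *m w^T)) 0 0](_ : _ = (w *m G p) 0 i); last first.
    by rewrite -rowE [LHS]mxE -[in LHS](gcomp_sym g (Oc Op)) -trmx_mul mxE.
  rewrite [e i *m (GV *m t j p)]mulmxA; ring.
under eq_bigr do under eq_bigr do rewrite split_sum.
under eq_bigr do rewrite sumrB big_split /= sumrN.
rewrite sumrB big_split /= sumrN base_sum opprK.
have -> : inner (ricci h d (F p)) (y *m D p) (w *m D p)
    = a * (lambda p * lambda p) * inner (g c p) y w.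
  have [_ _ _ _ confF] := conformalF.
  have := confF c d p (Oc Op) (Fd Op) _ _ hy hw.
  rewrite ricE /inner -scalemxAr -scalemxAl scalemxE => ->.
  by rewrite expr2 mulrA.
have yGw : \sum_j y 0 j * (e j *m (G p *m w^T)) 0 0 = inner (g c p) y w.
  by rewrite row_sum_mul mulmxA.
have -> : \sum_i \sum_j (e i *m GV *m t i p) 0 0 * (y 0 j * (e j *m (G p *m w^T)) 0 0)
   = (\sum_i (e i *m GV *m t i p) 0 0) * inner (g c p) y w.
  by rewrite mulr_suml; apply: eq_bigr => i _; rewrite -mulr_sumr yGw.
have -> : \sum_i \sum_j y 0 j * ((w *m G p) 0 i * (e i *m (GV *m t j p)) 0 0)
   = - (log_dilation_norm p * inner (g c p) y w).
  rewrite exchange_big /= -yGw mulr_sumr -sumrN; apply: eq_bigr => j _.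
  rewrite -mulr_sumr row_sum_mul [w *m _ *m (_ *m _)]mulmxA /GV (mulmxK uG).
  by rewrite (dilation_defect_horizontal j Op hw) mulmxA; ring.
rewrite /ricci_factor -/GV; ring.
Qed.

End AtPoint.
End RicciHorizontal.

(** * Ricci solitons *)

Section Soliton.
Variables (R : realType) (m n : nat) (M : manifold R m) (N : manifold R n).
Variables (g : metric M) (h : metric N) (F : M -> N) (lambda : M -> R).
Hypothesis conformalF : conformal_submersion g h F lambda.

Lemma horizontal_change c c' q v : dom c q -> dom c' q ->
  horizontal g F c q v -> horizontal g F c' q (v *m transition c c' q).
Proof.
move=> cq c'q hv u vu; apply/innerE.
have /innerE E := hv _ (vertical_change conformalF c'q cq vu).
rewrite (gcomp_change g c'q cq).
have TK := transitionK cq c'q.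
move: (transition c c' q) (transition c' c q) (g c q) TK E => T T' G TT' E.
rewrite -[RHS]E trmx_mul !mulmxA.
by rewrite -(mulmxA v) TT' mulmx1.
Qed.

Lemma inner_transition (T S : 'M[R]_m) (u v : 'rV[R]_m) :
  inner (T *m S *m T^T) u v = inner S (u *m T) (v *m T).
Proof. by rewrite /inner trmx_mul !mulmxA. Qed.

Hypothesis homotheticF : horizontally_homothetic g F lambda.
Hypothesis geodesicF : totally_geodesic_fibers g F.
Hypothesis integrableH : integrable_distribution n (horizontal g F).
Variables (Z : vector_field M) (mu : R).
Hypothesis solitonM : ricci_soliton g Z mu.
Variable a : R.
Hypothesis ricE : forall d p, dom d p -> ricci h d p = a *: h d p.

Lemma lie_metric_horizontal c d p y w : chart_region F c d p ->
  horizontal g F c p y -> horizontal g F c p w ->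
  inner (lie_metric Z g c p) y w
  = 2 * - (ricci_factor g lambda c a p + mu) * inner (g c p) y w.
Proof.
move=> Op hy hw; have [cp Fp] := Op.
have E := ricci_horizontal conformalF homotheticF geodesicF integrableH
  Op hy hw (ricE Fp).
have := congr1 (fun S : 'M[R]_m => inner S y w) (solitonM cp).
move: E; rewrite /inner !(mulmxDr, mulmxDl) -!(scalemxAr, scalemxAl) mulmx0 mul0mx.
rewrite !(addmxE, scalemxE, zeromxE) => ->.
set l := _ 0 0; set s := _ 0 0.
set k := ricci_factor _ _ _ _ _ => E.
have -> : l = 2 * (2^-1 * l + k * s + mu * s) - 2 * (k + mu) * s by field.
by rewrite E; ring.
Qed.

(** The factor is computed in one chart around [p]; it is the same in every other
    chart because the Lie derivative and the metric are tensors. *)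
Lemma lie_metric_horizontal_all p : exists f : R,
  forall c, dom c p -> forall y w,
  horizontal g F c p y -> horizontal g F c p w ->
  inner (lie_metric Z g c p) y w = 2 * f * inner (g c p) y w.
Proof.
have [c0 c0p] := atlas_cover p; have [d0 d0p] := atlas_cover (F p).
exists (- (ricci_factor g lambda c0 a p + mu)) => c cp y w hy hw.
rewrite (lie_metric_change Z g cp c0p) (gcomp_change g cp c0p).
rewrite !inner_transition.
have Op : chart_region F c0 d0 p by split.
by apply: (lie_metric_horizontal Op); exact: horizontal_change.
Qed.

End Soliton.

Theorem theorem4p5 (R : realType) (m n : nat)
    (M : manifold R m) (N : manifold R n) (g : metric M) (h : metric N)
    (F : M -> N) (lambda : M -> R) (Z : vector_field M) (mu : R)
    (conformalF : conformal_submersion g h F lambda)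
    (homotheticF : horizontally_homothetic g F lambda)
    (einsteinN : einstein h)
    (geodesicF : totally_geodesic_fibers g F)
    (integrableH : integrable_distribution n (horizontal g F))
    (horizontalZ : section_of (horizontal g F) Z)
    (solitonM : ricci_soliton g Z mu) :
  conformal_on (horizontal g F) g Z.
Proof.
have [a ricE] := einsteinN.
have /choice[f fE] := lie_metric_horizontal_all conformalF homotheticF geodesicF
  integrableH solitonM ricE.
(* If the base has dimension 0 there are no horizontal vectors but 0, and any
   factor will do; otherwise it is determined by its values on one non-zero
   horizontal vector, and agrees with a local smooth expression. *)
have [n0|n_gt0] := posnP n.
  exists (fun=> 0); first by move=> c k; exact: C_on_cst.
  move=> X Y hX _ c p cp.
  have [d dp] := atlas_cover (F p).
  have Op : chart_region F c d p by split.
  have X0 : X c p = 0.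
    rewrite ((horizontal_chart conformalF _ Op).1 (hX c p cp)).
    apply/rowP => j; rewrite [LHS]mxE [RHS]mxE big1 // => i.
    by have := ltn_ord i; rewrite {2}n0.
  by rewrite X0 /inner !mul0mx mxE mulr0.
exists f; last by move=> X Y hX hY c p cp; apply: fE => //; [exact: hX|exact: hY].
move=> c; apply: sm_local => p cp.
have [d dp] := atlas_cover (F p).
pose U := chart_region F c d.
have oU : open U := open_chart_region conformalF c d.
have Uc : U `<=` dom c := @chart_region_dom _ _ _ _ _ F c d.
exists U; split=> //.
apply: (sm_eq oU Uc (s := fun q => - (ricci_factor g lambda c a q + mu))).
  move=> q Uq.
  pose v : 'rV[R]_m := row (Ordinal n_gt0) (lift_matrix g h F lambda c d q).
  have LD := lift_differential conformalF Uq.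
  have vD : v *m differential F c d q = row (Ordinal n_gt0) 1%:M.
    by rewrite -row_mul LD.
  have hv : horizontal g F c q v.
    apply/(horizontal_chart conformalF _ Uq).
    by rewrite vD -row_mul mul1mx.
  have v0 : v != 0.
    apply: contraTneq isT => v0; move: vD; rewrite v0 mul0mx => /rowP.
    move=> /(_ (Ordinal n_gt0)); rewrite !mxE eqxx => /eqP.
    by rewrite eq_sym oner_eq0.
  have g0 := gcomp_pos g (Uc q Uq) v0.
  have := lie_metric_horizontal conformalF homotheticF geodesicF integrableH
    solitonM ricE Uq hv hv.
  rewrite (fE q c (Uc q Uq) v v hv hv).
  have two0 : (2 : R) != 0 by rewrite pnatr_eq0.
  by move=> /(mulIf (lt0r_neq0 g0)) /(mulfI two0) ->.
apply: (smN oU Uc); apply: (smD oU Uc); last exact: sm_cst.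
exact: (sm_ricci_factor conformalF c d a).
Qed.
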